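(* There is a constant $q_0$ such that the following holds. For every $\epsilon>0$ there is a constant $C_\epsilon>0$, depending only on $\epsilon$, such that for every integer $q\ge q_0$ satisfying $$ \operatorname{rad}(q) \leq \exp\left((\log q)^{3/4}\right), $$ every primitive Dirichlet character $\chi \pmod q$, and every real $x\ge 1$, $$ \left| S_\chi (x) \right| \le C_\epsilon\, \sqrt{q} \, (\log q)^{7/8 + \epsilon} . $$
   Context: For a Dirichlet character $\chi$ and real $x$, $S_\chi(x) := \sum_{n\le x}\chi(n)$, the sum being over positive integers $n\le x$. The radical of $q$ is $\operatorname{rad}(q) := \prod_{p \mid q} p$, the product of the distinct primes dividing $q$. *)

(* Defs.v *)
From HB Require Import structures.
From mathcomp Require Import all_boot all_order all_algebra.
From mathcomp Require Import all_classical all_reals all_analysis.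
From mathcomp Require Export complex.

Set Implicit Arguments.
Unset Strict Implicit.
Unset Printing Implicit Defensive.

Import Order.TTheory GRing.Theory Num.Theory.

Local Open Scope ring_scope.

(* Dirichlet characters modulo q, as functions on the integers extended by 0
   to the integers not coprime to q. *)
Record dirichlet_character (R : realType) (q : nat) := DirichletCharacter {
  dirichlet_fun :> int -> R[i];
  modulus_gt0 : (0 < q)%N;
  dirichlet_periodic : forall n, dirichlet_fun (n + q%:Z) = dirichlet_fun n;
  dirichlet_multiplicative : {morph dirichlet_fun : m n / m * n};
  dirichlet_support : forall n, (dirichlet_fun n != 0) = coprimez n q%:Z
}.

Definition induced_from (R : realType) (q : nat)
    (chi : dirichlet_character R q) (d : nat) : Prop :=
  exists psi : dirichlet_character R d,
    forall n : int, coprimez n q%:Z -> chi n = psi n.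

Definition primitive_character (R : realType) (q : nat)
    (chi : dirichlet_character R q) : Prop :=
  forall d : nat, (d %| q)%N -> induced_from chi d -> d = q.

(* [Num.truncn x] is the floor of x for x >= 0, and 0 for x < 0. *)
Definition char_sum (R : realType) (q : nat)
    (chi : dirichlet_character R q) (x : R) : R[i] :=
  \sum_(1 <= n < (Num.truncn x).+1) chi n%:Z.

Definition radn (q : nat) : nat := (\prod_(p <- primes q) p)%N.

(* Main.v *)
(* By Polya's completion method, S_chi(x) is 1 / tau, where |tau| = sqrt(q), times a combination
   of sums sum_a conj(chi a) z^a / sin(pi a / q) with |z| = 1, so everything rests on
   cancellation in sum_{n < N} chi(n) z^n for N well below q.  Let k be of size (log q)^(1/8)
   and choose e with q | e^(2k+2), e not much larger than q^(1/(2k+2)); this is where the bound on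
   rad(q) enters.  Put d = e^2 and shift n by e t + d y.  Since q | d^(k+1), the product
   prod_i (n + d y_i) depends modulo q only on the first k elementary symmetric functions of the
   y_i, so the s-th power of sum_y chi(n + d y) z^y is a sum over a box of such symmetric
   functions.  By primitivity of chi the vectors attached to the points n + e t, t < H, are
   orthogonal, and Bessel's inequality bounds the 2s-th moment over t by the size of the box times
   the number of solutions of Vinogradov's system sum y_i^j = sum y'_i^j, j <= k.  The latter is
   bounded by Linnik's p-adic method with p replaced by a power of 2.  This saves a factor k as soon
   as N exceeds a power of e, and log e is of size (log q)^(7/8). *)
Require Import Defs.
From HB Require Import structures.
From mathcomp Require Import all_boot all_order all_algebra.
From mathcomp Require Import all_classical all_reals all_analysis.
From mathcomp Require Import algC cyclotomic cyclic complex zify ring lra.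

Set Implicit Arguments.
Unset Strict Implicit.
Unset Printing Implicit Defensive.

Import Order.TTheory GRing.Theory Num.Theory.
Import numFieldNormedType.Exports.

Local Open Scope ring_scope.

(** * Power sums and elementary symmetric functions *)

(** Why [k] has size (log q)^(1/8): saving a factor [k] on the long sums gives sqrt(q) ((log q)/k +
    log e), where log e is at most about (log q)/(2k) + log rad(q). Bessel's inequality is useful
    only if the number H of points n + e t, at least about e / (k rad(q)^(2k+1)), exceeds the losses
    of the mean value theorem. The factor rad(q)^(2k+1) asks that k^2 log rad(q) be O(log q), which
    for log rad(q) = (log q)^(3/4) means k = O((log q)^(1/8)). The other loss is 2^O(k^6) against e,
    that is k^7 = O(log q), which is then satisfied. Why d is a square: moving n by e t must change
    the top character, attached to d^k, to first order, by d^k e, but not to second order, by d^k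
    e^2 = d^(k+1), which vanishes modulo q. A shift by d would be invisible. Why a power of 2: no
    prime has to be found in a prescribed range. Differences of distinct classes modulo 2^c are no
    longer units, but their 2-adic valuation stays below c, and this loss is affordable. *)

Lemma PoszX (m n : nat) : (m ^ n)%N%:Z = m%:Z ^+ n.
Proof. by elim: n => // n IH; rewrite expnS PoszM exprS IH. Qed.

Section PolyMod.
Variable A : comNzRingType.
Implicit Types P Q T : {poly A}.

Lemma eq_coef_mul n P Q P' Q' :
  (forall j, (j < n)%N -> P`_j = P'`_j) -> (forall j, (j < n)%N -> Q`_j = Q'`_j) ->
  forall j, (j < n)%N -> (P * Q)`_j = (P' * Q')`_j.
Proof.
move=> hP hQ j jn; rewrite !coefM; apply: eq_bigr => i _.
by rewrite hP ?hQ // (leq_ltn_trans _ jn) ?leq_subr // -ltnS.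
Qed.

(** As ['X] divides [1 - P], the truncated geometric series in [1 - P] inverts [P] up to degree [n],
    without any division in [A]. *)
Lemma trunc_inverse n P : P`_0 = 1 ->
  exists Q : {poly A}, forall j, (j < n)%N -> (P * Q)`_j = (1 : {poly A})`_j.
Proof.
move=> P0; exists (\sum_(i < n) (1 - P) ^+ i) => j jn.
have -> : P * \sum_(i < n) (1 - P) ^+ i = 1 - (1 - P) ^+ n.
  by rewrite -[RHS]opprB subrX1 addrAC subrr sub0r mulNr opprK.
have [T ->] : exists T, 1 - P = 'X * T.
  have /factor_theorem[T ->] : root (1 - P) 0.
    by rewrite rootE horner_coef0 coefB coef1 P0 subrr.
  by exists T; rewrite subr0 mulrC.
by rewrite exprMn coefB coefXnM jn subr0.
Qed.
End PolyMod.

Definition esym_poly (r : seq int) : {poly int} := \prod_(x <- r) (1 + x *: 'X).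
Definition psum (j : nat) (r : seq int) : int := \sum_(x <- r) x ^+ j.

Lemma psum0 r : psum 0 r = (size r)%:R.
Proof.
elim: r => [|x r IH]; first by rewrite /psum big_nil.
by move: IH; rewrite /psum big_cons expr0 /= => ->; rewrite -natr1 addrC.
Qed.

Lemma esym_poly_cons x r : esym_poly (x :: r) = (1 + x *: 'X) * esym_poly r.
Proof. by rewrite /esym_poly big_cons. Qed.

Lemma esym_poly_cat r1 r2 : esym_poly (r1 ++ r2) = esym_poly r1 * esym_poly r2.
Proof. by rewrite /esym_poly big_cat. Qed.

Lemma coef_esym_poly_cons x r j :
  (esym_poly (x :: r))`_j = (esym_poly r)`_j + (if j is i.+1 then x * (esym_poly r)`_i else 0).
Proof.
rewrite esym_poly_cons mulrDl mul1r coefD -scalerAl coefZ coefXM.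
by case: j => [|j] /=; rewrite ?mulr0.
Qed.

Lemma coef0_esym_poly r : (esym_poly r)`_0 = 1.
Proof.
elim: r => [|x r IH]; first by rewrite /esym_poly big_nil coef1.
by rewrite coef_esym_poly_cons IH addr0.
Qed.

Lemma coef1_esym_poly r : (esym_poly r)`_1 = psum 1 r.
Proof.
elim: r => [|x r IH]; first by rewrite /esym_poly /psum !big_nil coef1.
by rewrite coef_esym_poly_cons IH coef0_esym_poly mulr1 /psum big_cons expr1 addrC.
Qed.

Lemma size_esym_poly r j : (size r < j)%N -> (esym_poly r)`_j = 0.
Proof.
elim: r j => [|x r IH] [|j] //=; first by rewrite /esym_poly big_nil coef1.
by rewrite ltnS => h; rewrite coef_esym_poly_cons !IH ?mulr0 ?addr0 // ltnW.
Qed.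

Lemma esym_poly_scale (c : int) r j :
  (esym_poly [seq c * x | x <- r])`_j = c ^+ j * (esym_poly r)`_j.
Proof.
elim: r j => [|x r IH] [|j] /=.
- by rewrite /esym_poly !big_nil expr0 mul1r.
- by rewrite /esym_poly !big_nil coef1 mulr0.
- by rewrite !coef0_esym_poly expr0 mulr1.
by rewrite !coef_esym_poly_cons !IH exprS; ring.
Qed.

Lemma prod_esym_poly (a b : int) r :
  \prod_(x <- r) (b + x * a) =
  \sum_(j < (size r).+1) (esym_poly r)`_j * a ^+ j * b ^+ (size r - j).
Proof.
elim: r => [|x r IH]; first by rewrite big_nil big_ord1 coef0_esym_poly !mul1r.
rewrite big_cons IH mulrDl.
rewrite [RHS](eq_bigr (fun j : 'I_(size r).+2 => (esym_poly r)`_j * a ^+ j * b ^+ ((size r).+1 - j)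
   + (if (j : nat) is i.+1 then x * (esym_poly r)`_i else 0) * a ^+ j * b ^+ ((size r).+1 - j))); last first.
  by move=> j _; rewrite coef_esym_poly_cons !mulrDl.
rewrite [RHS]big_split /= [X in _ = X + _]big_ord_recr /= (size_esym_poly (r := r)) // !mul0r addr0.
congr (_ + _).
  rewrite mulr_sumr; apply: eq_bigr => j _.
  by rewrite subSn -1?ltnS // exprS; ring.
rewrite [RHS]big_ord_recl /= !mul0r add0r mulr_sumr; apply: eq_bigr => j _.
by rewrite /bump /= add1n subSS exprS; ring.
Qed.

Lemma coef_esym_poly_ge0 r j : (forall x, x \in r -> 0 <= x) -> 0 <= (esym_poly r)`_j.
Proof.
elim: r j => [|x r IH] j h; first by rewrite /esym_poly big_nil coef1 ler0n.
have hr y : y \in r -> 0 <= y by move=> yr; apply: h; rewrite in_cons yr orbT.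
have x0 : 0 <= x by apply: h; rewrite mem_head.
rewrite coef_esym_poly_cons addr_ge0 ?IH //.
by case: j => // j; rewrite mulr_ge0 ?IH.
Qed.

Lemma coef_esym_poly_le r j (Y : int) : (forall x, x \in r -> 0 <= x <= Y) ->
  (esym_poly r)`_j <= ((size r)%:Z * Y) ^+ j.
Proof.
elim: r j => [|x r IH] j h.
  by rewrite /esym_poly big_nil coef1 mul0r; case: j => [|j]; rewrite ?expr0 ?exprS ?mul0r.
have hr y : y \in r -> 0 <= y <= Y by move=> yr; apply: h; rewrite in_cons yr orbT.
have /andP[x0 xY] : 0 <= x <= Y by apply: h; rewrite mem_head.
have Y0 : 0 <= Y by apply: le_trans xY.
rewrite coef_esym_poly_cons; case: j => [|j]; first by rewrite coef0_esym_poly addr0 expr0.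
apply: (@le_trans _ _ (((size r)%:Z * Y) ^+ j.+1 + Y * ((size r)%:Z * Y) ^+ j)).
  apply: lerD; first exact: IH.
  apply: ler_pM => //; first by apply: coef_esym_poly_ge0 => y /hr/andP[].
  exact: IH.
rewrite exprS -mulrDl [X in _ <= X]exprS /=.
apply: ler_pM.
- by rewrite addr_ge0 // mulr_ge0.
- by rewrite exprn_ge0 // mulr_ge0.
- by rewrite intS mulrDl mul1r addrC.
- by rewrite lerXn2r ?nnegrE ?mulr_ge0 // ler_wpM2r // lez_nat.
Qed.

(* The logarithmic derivative of [esym_poly r], truncated to degree less than [k]. *)
Definition psum_poly (k : nat) (r : seq int) : {poly int} :=
  \poly_(j < k) ((-1) ^+ j * psum j.+1 r).

(** Newton's identities: the factor 1 + x X contributes x / (1 + x X) to the logarithmic derivative,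
    and [psum_poly] collects the truncations of these alternating geometric series. *)
Lemma deriv_esym_poly k r j : (j < k)%N ->
  ((esym_poly r)^`())`_j = (esym_poly r * psum_poly k r)`_j.
Proof.
elim: r j => [|x r IH] j jk.
  rewrite /esym_poly big_nil derivC mul1r coef0 coef_poly jk /psum big_nil mulr0.
  by [].
have -> : psum_poly k (x :: r) = psum_poly k r + \poly_(i < k) ((-1) ^+ i * x ^+ i.+1).
  apply/polyP => i; rewrite coefD !coef_poly /psum big_cons.
  by case: ifP => _; rewrite ?addr0 // -mulrDr addrC.
rewrite esym_poly_cons derivM mulrDr coefD derivD derivC derivZ derivX add0r addrC.
rewrite coefD; congr (_ + _).
  rewrite -mulrA; apply: (eq_coef_mul (n := k)) => // i ik; exact: IH.
rewrite [(1 + _) * _ * _]mulrAC.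
apply: (eq_coef_mul (n := k)) => // i ik.
rewrite mulrDl mul1r coefD -scalerAl !coefZ coefXM coef_poly ik coef1.
case: i ik => [|i] ik /=; first by rewrite !mulr0 addr0 mulr1 expr0 mul1r.
rewrite coef_poly (ltn_trans _ ik) // mulr0 !exprS; ring.
Qed.

(** Newton's identity expresses [j.+1] times coefficient [j.+1] through the power sums and earlier
    coefficients; the factor [j.+1] cancels because the integers are torsion-free. *)
Lemma psum_eq_esym k r1 r2 :
  (forall j, (0 < j <= k)%N -> psum j r1 = psum j r2) ->
  forall j, (j <= k)%N -> (esym_poly r1)`_j = (esym_poly r2)`_j.
Proof.
move=> h.
have hS : psum_poly k r1 = psum_poly k r2.
  by apply/polyP => i; rewrite !coef_poly; case: ifP => // ik; rewrite h.
elim/ltn_ind => [[|j]] IH jk; first by rewrite !coef0_esym_poly.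
have h1 := deriv_esym_poly r1 jk; have h2 := deriv_esym_poly r2 jk.
have : (esym_poly r1 * psum_poly k r1)`_j = (esym_poly r2 * psum_poly k r2)`_j.
  rewrite hS; apply: (eq_coef_mul (n := j.+1)) => // i ij.
  by apply: IH => //; apply: ltnW; apply: leq_trans ij jk.
rewrite -h1 -h2 !coef_deriv => /eqP.
by rewrite eqrMn2r // => /eqP.
Qed.

(** Newton's identities read backwards: a polynomial with constant term 1 can be cancelled modulo
    X^k, so the logarithmic derivative is determined. *)
Lemma esym_eq_psum k r1 r2 :
  (forall j, (j <= k)%N -> (esym_poly r1)`_j = (esym_poly r2)`_j) ->
  forall j, (0 < j <= k)%N -> psum j r1 = psum j r2.
Proof.
move=> h.
suff H j : (j < k)%N -> psum j.+1 r1 = psum j.+1 r2 by case=> // j /andP[_ /H].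
move=> jk.
have [Q hQ] := trunc_inverse k (coef0_esym_poly r1).
have hP : forall i, (i < k)%N -> (psum_poly k r1)`_i = (psum_poly k r2)`_i.
  have h0 : forall i, (i < k)%N -> (esym_poly r1 * psum_poly k r1)`_i =
                                  (esym_poly r1 * psum_poly k r2)`_i.
    move=> i ik; rewrite -(deriv_esym_poly _ ik) coef_deriv h // -coef_deriv (deriv_esym_poly _ ik).
    by apply: (eq_coef_mul (n := k)) => // i' i'k; rewrite h // ltnW.
  have h1 (P : {poly int}) : forall i, (i < k)%N -> P`_i = (Q * (esym_poly r1 * P))`_i.
    move=> i ik; rewrite mulrA -{1}[P]mul1r.
    by apply: (eq_coef_mul (n := k)) => // i' i'k; rewrite mulrC hQ.
  by move=> i ik; rewrite h1 // [RHS]h1 //; apply: (eq_coef_mul (n := k)).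
have := hP _ jk; rewrite !coef_poly jk => /(congr1 (fun x => (-1) ^+ j * x)).
by rewrite !mulrA -!expr2 !sqrr_sign !mul1r.
Qed.

(** Translation and dilation invariance of Vinogradov's system: write [c * x] as [(a + c * x) - a]
    and expand its [j]-th power, which involves only powers up to [j]. The zeroth power sums agree
    because the lengths do. *)
Lemma psum_affine (a c : int) k r1 r2 : c != 0 -> size r1 = size r2 ->
  (forall j, (0 < j <= k)%N -> psum j [seq a + c * x | x <- r1] = psum j [seq a + c * x | x <- r2]) ->
  forall j, (0 < j <= k)%N -> psum j r1 = psum j r2.
Proof.
move=> c0 hs h j /andP[j0 jk].
have key r : c ^+ j * psum j r =
    \sum_(i < j.+1) ((- a) ^+ (j - i) *+ 'C(j, i)) * psum i [seq a + c * x | x <- r].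
  rewrite /psum mulr_sumr; under [RHS]eq_bigr do rewrite big_map mulr_sumr.
  rewrite exchange_big /=; apply: eq_bigr => x _.
  rewrite -exprMn -{1}[c * x](addKr a) exprDn; apply: eq_bigr => i _.
  by rewrite mulrnAl.
apply: (mulfI (x := c ^+ j)); first by rewrite expf_neq0.
rewrite !key; apply: eq_bigr => [[[|i] hi]] _ /=.
  by rewrite !psum0 !size_map hs.
by rewrite h //= (leq_trans _ jk).
Qed.

(** * Congruences in distinct residue classes *)

(** The substitute for cancelling a unit: a factor of 2-adic valuation below [c] costs at most [c]
    in the exponent. *)
Lemma dvdn_pfactor_mull (c m d D : nat) :
  ~~ (2 ^ c %| d)%N -> (2 ^ (m + c) %| d * D)%N -> (2 ^ m %| D)%N.
Proof.
have [->|D0] := posnP D; first by rewrite dvdn0.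
have [->|d0] := posnP d; first by rewrite dvdn0.
by rewrite !pfactor_dvdn ?muln_gt0 ?d0 // lognM //; lia.
Qed.

Lemma dvdz_pfactor_prod (I : eqType) (r : seq I) (F : I -> int) (c m : nat) (D : int) :
  (forall i, i \in r -> ~~ ((2 ^ c)%:Z %| F i)%Z) ->
  ((2 ^ (m + c * size r))%:Z %| D * \prod_(i <- r) F i)%Z -> ((2 ^ m)%:Z %| D)%Z.
Proof.
elim: r => [|i r IH] h; first by rewrite muln0 addn0 big_nil mulr1.
rewrite big_cons mulrCA /= mulnS addnCA addnC => H.
apply: IH => [j jr|]; first by apply: h; rewrite in_cons jr orbT.
move: H; rewrite !dvdzE !absz_nat [`|(F i * _)%R|%N]abszM; apply: dvdn_pfactor_mull.
by have := h i (mem_head _ _); rewrite dvdzE.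
Qed.

Lemma coef_comp_scaleX (A : comNzRingType) (P : {poly A}) (c : A) j :
  (P \Po (c *: 'X))`_j = c ^+ j * P`_j.
Proof.
rewrite comp_polyE coef_sum.
under eq_bigr => i _ do rewrite exprZn !coefZ coefXn.
have [jP|Pj] := ltnP j (size P); last first.
  rewrite [P`_j]nth_default // mulr0 big1 // => i _.
  by rewrite gtn_eqF ?(leq_trans _ Pj) // !mulr0.
rewrite (bigD1 (Ordinal jP)) //= eqxx mulr1 mulrC big1 ?addr0 // => i /eqP ij.
by rewrite [_ == _]negbTE ?mulr0 //; apply/eqP => e; apply: ij; apply/val_inj.
Qed.

(** Modulo [N] the product agrees with the product over [X], since both are the same polynomial in
    elementary symmetric functions, and the latter contains the factor [x - x]. *)
Lemma dvdz_prod_of_esym (k N : nat) (X Z : seq int) (x : int) :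
  size X = size Z -> x \in X ->
  (forall j, (j <= size X)%N -> (N%:Z %| (esym_poly X)`_j - (esym_poly Z)`_j)%Z) ->
  (N%:Z %| \prod_(z <- Z) (x - z))%Z.
Proof.
move=> sXZ xX h.
have e (r : seq int) : \prod_(z <- r) (x - z) = \prod_(z <- r) (x + z * -1).
  by apply: eq_bigr => z _; rewrite mulrN1.
have e0 : \prod_(z <- X) (x - z) = 0.
  by apply/eqP; rewrite prodf_seq_eq0; apply/hasP; exists x => //=; rewrite subrr.
rewrite -[X in (_ %| X)%Z]subr0 -{}e0 !e !prod_esym_poly -sXZ -sumrB.
rewrite rpred_sum // => j _.
rewrite -mulrBl -mulrBl !dvdz_mulr // -opprB rpredN; apply: h.
by rewrite -ltnS.
Qed.

(** In generating functions the hypothesis is E_X(T) E_u(cT) = E_X'(T) E_u'(cT) modulo T^(k+1), so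
    [w] is the coefficient sequence of E_u'/E_u. Since [w i] occurs only multiplied by [c ^ i], the
    precision needed on it decreases with [i]. *)
Lemma esym_factor (k : nat) (c : int) (X X' u u' : seq int) :
  (forall j, (0 < j <= k)%N -> psum j (X ++ [seq c * v | v <- u]) =
                              psum j (X' ++ [seq c * v | v <- u'])) ->
  exists w : nat -> int, w 0 = 1 /\ forall j, (j <= k)%N ->
    (esym_poly X)`_j = \sum_(i < j.+1) (c ^+ i * w i) * (esym_poly X')`_(j - i).
Proof.
move=> /psum_eq_esym h.
have [Q hQ] := trunc_inverse k.+1 (coef0_esym_poly u).
exists (fun i => (esym_poly u' * Q)`_i); split.
  by have := hQ 0 isT; rewrite !coefM !big_ord1 !coef0_esym_poly coef1.
have sc (r : seq int) : esym_poly [seq c * v | v <- r] = esym_poly r \Po (c *: 'X).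
  by apply/polyP => i; rewrite esym_poly_scale coef_comp_scaleX.
move=> j jk.
transitivity ((((esym_poly u' * Q) \Po (c *: 'X)) * esym_poly X')`_j); last first.
  by rewrite coefM; apply: eq_bigr => i _; rewrite coef_comp_scaleX.
have h' : forall i, (i < k.+1)%N -> (esym_poly X * (esym_poly u \Po (c *: 'X)))`_i =
   (esym_poly X' * (esym_poly u' \Po (c *: 'X)))`_i.
  by move=> i; rewrite ltnS => ik; rewrite -!sc -!esym_poly_cat h.
have h1 : forall i, (i < k.+1)%N -> ((esym_poly u \Po (c *: 'X)) * (Q \Po (c *: 'X)))`_i =
   (1 : {poly int})`_i.
  move=> i ik; rewrite -comp_polyM coef_comp_scaleX hQ // coef1.
  by case: i {ik} => [|i]; rewrite ?expr0 ?mul1r ?mulr0.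
transitivity ((esym_poly X * ((esym_poly u \Po (c *: 'X)) * (Q \Po (c *: 'X))))`_j).
  by rewrite -{1}[esym_poly X]mulr1; apply: (eq_coef_mul (n := k.+1)) => // i ik; rewrite h1.
rewrite mulrA comp_polyM [_ * esym_poly X']mulrC [esym_poly X' * _]mulrA.
by apply: (eq_coef_mul (n := k.+1)).
Qed.

(** Linnik's counting lemma. The first factor is the classical count, q^(k(k-1)/2) with q = (2^c)^a.
    The second is the price of a modulus 2^c that is not prime: for each of the [k] variables,
    comparison with the [k.-1] other classes may lose a factor 2^c each time. *)
Lemma card_congruence (k c a U : nat) (alpha : 'I_k -> nat) (b : int) (X' : seq int)
    (S : {set {ffun 'I_k -> 'I_U}}) :
  (0 < a)%N -> (forall i, (alpha i < 2 ^ c)%N) -> injective alpha ->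
  (2 ^ c * U <= (2 ^ c) ^ (a * k))%N ->
  (forall x, x \in S -> exists u u' : seq int, forall j, (0 < j <= k)%N ->
     psum j ([seq (alpha i + 2 ^ c * x i)%:Z - b | i <- enum 'I_k] ++
             [seq ((2 ^ c) ^ a)%:Z * v | v <- u]) =
     psum j (X' ++ [seq ((2 ^ c) ^ a)%:Z * v | v <- u'])) ->
  (#|S| <= (\prod_(i < k) ((2 ^ c) ^ a) ^ (k - i.+1)) * ((2 ^ c) ^ k.-1) ^ k)%N.
Proof.
move=> a0 alpha_lt alphaI hU hS.
pose p := (2 ^ c)%N; pose q := (p ^ a)%N.
have p0 : (0 < p)%N by rewrite expn_gt0.
have q0 : (0 < q)%N by rewrite expn_gt0 p0.
pose vx (x : {ffun 'I_k -> 'I_U}) (i : 'I_k) : int := (alpha i + p * nat_of_ord (x i))%:Z - b.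
pose X (x : {ffun 'I_k -> 'I_U}) := [seq vx x i | i <- enum 'I_k].
have sX x : size (X x) = k by rewrite size_map size_enum_ord.
have hW0 x : x \in S -> exists w : nat -> int, w 0 = 1 /\ forall j, (j <= k)%N ->
    (esym_poly (X x))`_j = \sum_(i < j.+1) (q%:Z ^+ i * w i) * (esym_poly X')`_(j - i).
  move=> /hS[u [u' h]]; exact: esym_factor h.
have hW x : exists w : nat -> int, x \in S -> w 0 = 1 /\ forall j, (j <= k)%N ->
    (esym_poly (X x))`_j = \sum_(i < j.+1) (q%:Z ^+ i * w i) * (esym_poly X')`_(j - i).
  by have [/hW0[w hw]|_] := boolP (x \in S); [exists w | exists (fun=> 0)].
have {hW hW0} [w hw] := fin_all_exists hW.
(* The residues of the [w x j] modulo [q ^ (k - j)] determine the elementary symmetric functions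
   of [X x] modulo [q ^ k], hence each [vx x i] modulo [p ^ (a * k - k.-1)] by Hensel's argument. *)
pose N (i : 'I_k) := (q ^ (k - i.+1))%N.
have N0 i : (0 < N i)%N by rewrite expn_gt0 q0.
have red_lt x (i : 'I_k) : (`|(w x i.+1 %% (N i)%:Z)%Z| < N i)%N.
  have NZ : (N i)%:Z != 0 by rewrite -lt0n.
  by rewrite -ltz_nat gez0_abs ?modz_ge0 // ltz_pmod // ltz_nat.
pose code x : {dffun forall i : 'I_k, 'I_(N i)} := [ffun i : 'I_k => Ordinal (red_lt x i)].
(* The values are below [p ^ (a * k)], so a residue modulo [p ^ (a * k - k.-1)] leaves at most
   [p ^ k.-1] candidates, which the quotient tells apart. *)
have quo_lt (x : {ffun 'I_k -> 'I_U}) i : ((alpha i + p * x i) %/ p ^ (a * k - k.-1) < p ^ k.-1)%N.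
  rewrite ltn_divLR ?expn_gt0 ?p0 // -expnD subnKC; last by nia.
  apply: leq_trans hU; have := ltn_ord (x i); have := alpha_lt i; rewrite -/p.
  move: (nat_of_ord (x i)) (alpha i) => y z; nia.
pose quo (x : {ffun 'I_k -> 'I_U}) : {ffun 'I_k -> 'I_(p ^ k.-1)} :=
  [ffun i => Ordinal (quo_lt x i)].
have inj : {in S &, injective (fun x => (code x, quo x))}.
  move=> x z xS zS [ecode equo]; apply/ffunP => i.
  have [wx0 hx] := hw x xS; have [wz0 hz] := hw z zS.
  have hcode j : (j <= k)%N -> ((q ^ k)%:Z %| (esym_poly (X x))`_j - (esym_poly (X z))`_j)%Z.
    move=> jk; rewrite hx // hz // -sumrB rpred_sum // => l _.
    rewrite -mulrBl dvdz_mulr // -mulrBr.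
    case: l => [[|l] hl] /=; first by rewrite wx0 wz0 subrr mulr0 dvdz0.
    have lk : (l < k)%N by apply: leq_trans jk; rewrite -ltnS.
    have -> : (q ^ k)%:Z = q%:Z ^+ l.+1 * (N (Ordinal lk))%:Z.
      by rewrite -rmorphXn -PoszM -expnD /= subnKC.
    rewrite dvdz_mul //.
    have /(congr1 val) := congr1 (fun f : {dffun _} => f (Ordinal lk)) ecode.
    rewrite !ffunE /= => e.
    have NZ : (N (Ordinal lk))%:Z != 0 by rewrite -lt0n.
    have : (w x l.+1 %% (N (Ordinal lk))%:Z)%Z = (w z l.+1 %% (N (Ordinal lk))%:Z)%Z.
      by rewrite -[LHS]gez0_abs ?modz_ge0 // e gez0_abs ?modz_ge0.
    by move/eqP; rewrite eqz_mod_dvd.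
  have hprod : ((q ^ k)%:Z %| \prod_(y <- X z) (vx x i - y))%Z.
    apply: (dvdz_prod_of_esym k (X := X x)); rewrite ?sX //.
    by apply: map_f; rewrite mem_enum.
  (* Only the factor of index [i] can be highly divisible by 2: the other [k.-1] factors come from
     distinct classes modulo [p], so none of them is divisible by [p]. *)
  have hi : ((2 ^ (c * (a * k - k.-1)))%:Z %| vx x i - vx z i)%Z.
    move: hprod; rewrite big_map (bigD1_seq i) ?mem_enum ?enum_uniq //=.
    rewrite -big_filter => hprod.
    set r := [seq _ <- _ | _] in hprod.
    have sr : size r = k.-1.
      have h1 := count_predC (pred1 i) (enum 'I_k).
      rewrite count_uniq_mem ?enum_uniq // mem_enum size_enum_ord add1n in h1.
      by rewrite size_filter; apply: etrans (congr1 predn h1); apply: eq_count.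
    apply: (dvdz_pfactor_prod (r := r) (F := fun j => vx x i - vx z j) (c := c)).
      move=> j; rewrite mem_filter => /andP[ji _].
      have {}ji : alpha j != alpha i by apply: contra ji => /eqP/alphaI ->.
      have -> : vx x i - vx z j =
         (alpha i)%:Z - (alpha j)%:Z + p%:Z * ((x i)%:Z - (z j)%:Z).
        by rewrite /vx !PoszD !PoszM; ring.
      apply/negP => h1; have := dvdz_mulr ((x i)%:Z - (z j)%:Z) (dvdzz p).
      move=> /(rpredB h1); rewrite addrK -eqz_mod_dvd !modz_small ?lez_nat ?ltz_nat ?alpha_lt //.
      by rewrite eqz_nat eq_sym (negbTE ji).
    move: hprod; rewrite sr /q /p -!expnM -mulnDr subnK ?mulnA //; nia.
  have ei : (alpha i + p * x i = alpha i + p * z i)%N.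
    have /(congr1 val) := congr1 (fun f : {ffun _} => f i) equo; rewrite !ffunE /= => e.
    have : ((p ^ (a * k - k.-1))%:Z %| (alpha i + p * x i)%:Z - (alpha i + p * z i)%:Z)%Z.
      by move: hi; rewrite expnM /vx; congr (_ %| _)%Z; rewrite opprB addrA subrK.
    rewrite -eqz_mod_dvd !modz_nat => /eqP[e2].
    by rewrite (divn_eq (alpha i + p * x i) (p ^ (a * k - k.-1))) e e2 -divn_eq.
  by apply/val_inj/eqP; move/eqP: ei; rewrite eqn_add2l eqn_pmul2l.
rewrite -(card_in_imset inj) (leq_trans (max_card _)) // card_prod card_dep_ffun card_ffun !card_ord.
rewrite leq_mul // foldrE big_map big_enum /=; apply: eq_leq.
by apply: eq_bigr => i _; rewrite card_ord.
Qed.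

(** * The mean value theorem *)

(** Induction by Chebyshev's sum inequality, which after doubling is the sum over all pairs of the
    nonnegative products (x_j - x_i)(x_j^(m+1) - x_i^(m+1)). Elements of [R] need not be comparable,
    but nonnegative ones are. *)
Lemma power_mean (R : numFieldType) (I : finType) (A : {set I}) (x : I -> R) (m : nat) :
  (forall i, i \in A -> 0 <= x i) ->
  (\sum_(i in A) x i) ^+ m.+1 <= #|A|%:R ^+ m * \sum_(i in A) x i ^+ m.+1.
Proof.
move=> x0; elim: m => [|m IH]; first by rewrite mul1r lexx.
have cheb : (\sum_(i in A) x i) * (\sum_(i in A) x i ^+ m.+1) <=
            #|A|%:R * \sum_(i in A) x i ^+ m.+2.
  rewrite -(ler_pM2l (ltr0n R 2)) !mulr_natl !mulr2n.
  have e1 : (\sum_(i in A) x i) * (\sum_(i in A) x i ^+ m.+1) =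
      \sum_(i in A) \sum_(j in A) x i * x j ^+ m.+1 by rewrite big_distrlr.
  have e2 : (\sum_(i in A) x i ^+ m.+2) *+ #|A| = \sum_(i in A) \sum_(j in A) x i ^+ m.+2.
    by rewrite -sumrMnl; apply: eq_bigr => i _; rewrite sumr_const.
  have e1' : (\sum_(i in A) x i) * (\sum_(i in A) x i ^+ m.+1) =
      \sum_(i in A) \sum_(j in A) x j * x i ^+ m.+1.
    by rewrite e1 exchange_big.
  have e2' : (\sum_(i in A) x i ^+ m.+2) *+ #|A| = \sum_(i in A) \sum_(j in A) x j ^+ m.+2.
    by rewrite e2 exchange_big.
  rewrite {1}e1 e1' {1}e2 e2' -!big_split /=; apply: ler_sum => i iA.
  rewrite -!big_split /=; apply: ler_sum => j jA.
  wlog ij : i j iA jA / x i <= x j => [H|].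
    have /orP[|ij] := ger_leVge (x0 i iA) (x0 j jA); first exact: H.
    by rewrite addrC [leRHS]addrC; apply: H.
  rewrite -subr_ge0.
  have -> : x i ^+ m.+2 + x j ^+ m.+2 - (x i * x j ^+ m.+1 + x j * x i ^+ m.+1)
     = (x j - x i) * (x j ^+ m.+1 - x i ^+ m.+1) by rewrite !exprS; ring.
  by rewrite mulr_ge0 // subr_ge0 // lerXn2r // nnegrE x0.
rewrite exprS; apply: (@le_trans _ _ (#|A|%:R ^+ m *
   ((\sum_(i in A) x i) * \sum_(i in A) x i ^+ m.+1))).
  by rewrite mulrCA ler_wpM2l // sumr_ge0.
by rewrite [X in _ <= X * _]exprSr -mulrA ler_wpM2l // exprn_ge0.
Qed.

(* Either fewer than [k] of the [z a] reach the threshold [\sum_a z a / (2 * p)],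
   and then these few already carry half of the sum, or [k] distinct ones do. *)
Lemma sum_pow_le_distinct (R : numFieldType) (p k s : nat) (z : 'I_p -> R) :
  (0 < k)%N -> (forall a, 0 <= z a) ->
  (\sum_a z a) ^+ (2 * (s + k)) <=
  (2 * k)%:R ^+ (2 * (s + k)) * \sum_a z a ^+ (2 * (s + k)) +
  (2 * p)%:R ^+ (2 * (s + k)) *
    \sum_(t : {ffun 'I_k -> 'I_p} | injectiveb t) (\prod_i z (t i) ^+ 2) * \sum_b z b ^+ (2 * s).
Proof.
move=> k0 z0; set n := (2 * (s + k))%N.
have n0 : (0 < n)%N by rewrite /n; lia.
set S := \sum_a z a; have S0 : 0 <= S by rewrite sumr_ge0.
have zn0 m : 0 <= \sum_b z b ^+ m by rewrite sumr_ge0 // => b _; rewrite exprn_ge0.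
have T0 (t : {ffun 'I_k -> 'I_p}) : 0 <= (\prod_i z (t i) ^+ 2) * \sum_b z b ^+ (2 * s).
  by rewrite mulr_ge0 // prodr_ge0 // => i _; rewrite exprn_ge0.
have T1 : 0 <= \sum_(t : {ffun 'I_k -> 'I_p} | injectiveb t) (\prod_i z (t i) ^+ 2) * \sum_b z b ^+ (2 * s).
  by rewrite sumr_ge0.
have [p0|p0] := posnP p.
  have -> : S = 0 by rewrite /S big1 // => a; have := leq_ltn_trans (leq0n a) (ltn_ord a); rewrite [in X in X -> _]p0.
  rewrite expr0n gtn_eqF //; apply: addr_ge0; by rewrite mulr_ge0 ?exprn_ge0 ?ler0n ?zn0 ?T1.
have p2 : 0 < (2 * p)%:R :> R by rewrite ltr0n muln_gt0.
pose mu := S / (2 * p)%:R; have mu0 : 0 <= mu by rewrite divr_ge0 // ltW.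
have muE : S = (2 * p)%:R * mu by rewrite mulrC divfK // gt_eqF.
pose A := [set a | mu <= z a].
have [kA|Ak] := leqP k #|A|.
  apply: ler_wpDl; first by rewrite mulr_ge0 ?exprn_ge0 ?ler0n ?zn0.
  rewrite {1}muE exprMn ler_wpM2l ?exprn_ge0 ?(ltW p2) //.
  pose t : {ffun 'I_k -> 'I_p} := [ffun i => enum_val (widen_ord kA i)].
  have tI : injectiveb t.
    apply/injectiveP => i j; rewrite !ffunE => /enum_val_inj/(congr1 val) e.
    exact/val_inj.
  rewrite (bigD1 t) //= ler_wpDr ?sumr_ge0 //.
  have tA i : mu <= z (t i).
    by have := enum_valP (widen_ord kA i); rewrite inE ffunE.
  rewrite /n mulnDr addnC exprD ler_pM ?exprn_ge0 //.
    have -> : mu ^+ (2 * k) = \prod_(i < k) mu ^+ 2 by rewrite prodr_const card_ord exprM.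
    by apply: ler_prod => i _; rewrite exprn_ge0 //= lerXn2r // nnegrE.
  rewrite (bigD1 (t (Ordinal k0))) //= ler_wpDr ?sumr_ge0 // => [i _|]; first by rewrite exprn_ge0.
  by rewrite lerXn2r // nnegrE.
apply: ler_wpDr; first by rewrite mulr_ge0 ?exprn_ge0 ?ler0n ?T1.
(* The terms outside [A] contribute at most [p * mu], which is half of [S]. *)
have SA : S <= 2 * \sum_(a in A) z a.
  have h : S <= \sum_(a in A) z a + S / 2.
    rewrite {1}/S (bigID (mem A)) /= lerD2l.
    apply: (@le_trans _ _ (\sum_(a | a \notin A) mu)).
      by apply: ler_sum => a; rewrite inE -real_ltNge ?ger0_real // => /ltW.
    apply: (@le_trans _ _ (\sum_(a : 'I_p) mu)).
      by rewrite [leRHS](bigID (mem A)) /= ler_wpDl // sumr_ge0.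
    have pn0 : p%:R != 0 :> R by rewrite pnatr_eq0 -lt0n.
    rewrite sumr_const card_ord [leRHS](_ : _ = mu *+ p) // muE -mulr_natl natrM.
    by field.
  have : S / 2 <= \sum_(a in A) z a.
    by rewrite -(lerD2r (S / 2)) -splitr.
  by rewrite ler_pdivrMr ?ltr0n // mulrC.
have A0 : 0 <= \sum_(a in A) z a by rewrite sumr_ge0.
apply: (@le_trans _ _ ((2 * \sum_(a in A) z a) ^+ n)).
  by rewrite lerXn2r // nnegrE // mulr_ge0.
rewrite exprMn natrM exprMn -mulrA ler_wpM2l ?exprn_ge0 //.
rewrite -(prednK n0); apply: (le_trans (power_mean _ _)) => //.
apply: ler_pM.
- by rewrite exprn_ge0.
- by rewrite sumr_ge0 // => a _; rewrite exprn_ge0.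
- rewrite exprS -[leLHS]mul1r. apply: ler_pM; [by []|by rewrite exprn_ge0|by rewrite ler1n|].
  by rewrite lerXn2r ?nnegrE ?ler0n // ler_nat; apply: ltnW.
by rewrite [leRHS](bigID (mem A)) /= ler_wpDr // sumr_ge0 // => a _; rewrite exprn_ge0.
Qed.

Lemma sum_ord_mul (R : nmodType) (m U : nat) (F : nat -> R) :
  \sum_(y < m * U) F y = \sum_(a < m) \sum_(u < U) F (a + m * u)%N.
Proof.
rewrite exchange_big /=; elim: U => [|U IH]; first by rewrite muln0 !big_ord0.
rewrite big_ord_recr /= -IH mulnSr big_split_ord /=; congr (_ + _).
by apply: eq_bigr => i _; rewrite addnC.
Qed.

(** * Additive characters on a finite grid *)

Section FiniteFourier.
Variables (C : numClosedFieldType) (M : nat) (w : C).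
Hypothesis wM : M.-primitive_root w.

Let M0 : (0 < M)%N := prim_order_gt0 wM.

Lemma prim_root_norm : `|w| = 1.
Proof.
apply/eqP; rewrite -(@pexpr_eq1 _ _ M) // -normrX.
by rewrite (prim_expr_order wM) normr1.
Qed.

Lemma sum_prim_root_conj (v v' : nat) : (v < M)%N -> (v' < M)%N ->
  \sum_(a < M) (w ^+ (a * v)) * (w ^+ (a * v'))^* = M%:R * (v == v')%:R.
Proof.
move=> vM v'M; pose z := w ^+ v * (w ^+ v')^*.
have nz m : w ^+ m * (w ^+ m)^* = 1 by rewrite -normCK normrX prim_root_norm !expr1n.
have e : \sum_(a < M) (w ^+ (a * v)) * (w ^+ (a * v'))^* = \sum_(a < M) z ^+ a.
  by apply: eq_bigr => a _; rewrite /z exprMn -rmorphXn -!exprM [(v * a)%N]mulnC [(v' * a)%N]mulnC.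
have zM : z ^+ M = 1.
  rewrite /z exprMn -rmorphXn -!exprM mulnC [(v' * M)%N]mulnC !exprM.
  by rewrite (prim_expr_order wM) !expr1n mul1r rmorph1.
rewrite e; have [vv|vv'] := eqVneq v v'.
  rewrite (eq_bigr (fun=> 1)) ?sumr_const ?card_ord ?mulr1 // => a _.
  by rewrite /z vv nz expr1n.
rewrite mulr0; apply/eqP.
have z1 : z - 1 != 0.
  apply: contra_neq vv' => /eqP; rewrite subr_eq0 => /eqP z1.
  have : w ^+ v = w ^+ v'.
    by rewrite -[LHS]mulr1 -(nz v') mulrCA mulrC -/z z1 mul1r.
  move/eqP; rewrite (eq_prim_root_expr wM) !modn_small // => /eqP.
  by [].
by rewrite -(inj_eq (mulfI z1)) -subrX1 zM subrr mulr0.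
Qed.

Variable k : nat.
Implicit Types (al : {ffun 'I_k -> 'I_M}) (V : 'I_k -> nat).

(** The additive character e(al . V / M). The finite grid of the [al] replaces the torus: once [M]
    exceeds all coordinates that occur, averaging over the grid detects equality of integers rather
    than congruence modulo [M]. *)
Definition fchar al V : C := w ^+ (\sum_j al j * V j).

Lemma norm_fchar al V : `|fchar al V| = 1.
Proof. by rewrite normrX prim_root_norm expr1n. Qed.

Lemma fcharD al V V' : fchar al (fun j => V j + V' j)%N = fchar al V * fchar al V'.
Proof.
by rewrite /fchar -exprD -big_split; congr (_ ^+ _); apply: eq_bigr => j _; rewrite mulnDr.
Qed.

Lemma fchar_sum al (I : finType) (V : I -> 'I_k -> nat) :
  fchar al (fun j => \sum_i V i j)%N = \prod_i fchar al (V i).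
Proof.
rewrite -expr_sum exchange_big; congr (_ ^+ _); apply: eq_bigr => j _.
by rewrite big_distrr.
Qed.

Lemma fchar_orth V V' : (forall j, V j < M)%N -> (forall j, V' j < M)%N ->
  \sum_al fchar al V * (fchar al V')^* = M%:R ^+ k * [forall j, V j == V' j]%:R.
Proof.
move=> hV hV'.
transitivity (\prod_(j < k) \sum_(a < M) (w ^+ (a * V j)) * (w ^+ (a * V' j))^*).
  rewrite bigA_distr_bigA; apply: eq_bigr => al _.
  by rewrite /fchar !expr_sum rmorph_prod -big_split.
under eq_bigr do rewrite sum_prim_root_conj //.
rewrite big_split /= prodr_const card_ord; congr (_ * _).
have [/forallP h|] := boolP [forall j, V j == V' j].
  by rewrite big1 // => j _; rewrite h.
rewrite negb_forall => /existsP[j /negbTE hj].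
by rewrite (bigD1 j) //= hj mul0r.
Qed.

Lemma fchar_sum_sqr (I : finType) (V : I -> 'I_k -> nat) : (forall i j, V i j < M)%N ->
  \sum_al `|\sum_i fchar al (V i)| ^+ 2 =
  M%:R ^+ k * #|[set ii : I * I | [forall j, V ii.1 j == V ii.2 j]]|%:R.
Proof.
move=> hV; under eq_bigr do rewrite normCK rmorph_sum big_distrlr.
rewrite exchange_big /=; under eq_bigr do rewrite exchange_big /=.
under eq_bigr => i _ do under eq_bigr do rewrite fchar_orth //.
rewrite pair_big -mulr_sumr -natr_sum; congr (_ * _%:R).
rewrite -big_mkcond sum1_card; apply: eq_card => x; by rewrite !inE.
Qed.

Definition curve_pt (y : nat) (j : 'I_k) : nat := (y ^ j.+1)%N.

Definition curve_sum (a m U : nat) al : C := \sum_(u < U) fchar al (curve_pt (a + m * u)).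

Lemma curve_sum_pow n a m U al :
  curve_sum a m U al ^+ n =
  \sum_(u : {ffun 'I_n -> 'I_U}) fchar al (fun j => \sum_i curve_pt (a + m * u i) j)%N.
Proof.
rewrite -[n in LHS](card_ord n) -prodr_const /curve_sum bigA_distr_bigA.
by apply: eq_bigr => u _; rewrite fchar_sum.
Qed.

Lemma curve_sum_prod n (a : 'I_n -> nat) m U al :
  \prod_i curve_sum (a i) m U al =
  \sum_(u : {ffun 'I_n -> 'I_U}) fchar al (fun j => \sum_i curve_pt (a i + m * u i) j)%N.
Proof.
rewrite /curve_sum bigA_distr_bigA.
by apply: eq_bigr => u _; rewrite fchar_sum.
Qed.

Lemma curve_sum_split a d m U al :
  curve_sum a d (m * U) al = \sum_(t < m) curve_sum (a + d * t) (d * m) U al.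
Proof.
rewrite /curve_sum (sum_ord_mul m U (fun y => fchar al (curve_pt (a + d * y)%N))).
by apply: eq_bigr => t _; apply: eq_bigr => u _; rewrite mulnDr mulnA addnA.
Qed.
End FiniteFourier.

(** Vinogradov's mean value J_{n,k}(U), with variables running from 0 to U - 1. *)
Definition mean_value (k n U : nat) : nat :=
  #|[set u : {ffun 'I_n -> 'I_U} * {ffun 'I_n -> 'I_U} |
     [forall j : 'I_k, \sum_i u.1 i ^ j.+1 == \sum_i u.2 i ^ j.+1]%N]|.

Lemma psum_nat (n : nat) (f : 'I_n -> nat) (j : nat) :
  psum j [seq (f i)%:Z | i <- enum 'I_n] = (\sum_i f i ^ j)%:Z.
Proof.
rewrite /psum big_map big_enum /= (big_morph Posz PoszD (erefl _)).
by apply: eq_bigr => i _; rewrite rmorphXn.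
Qed.

Lemma mean_value_curve_pt_affine (k n U a m : nat) : (0 < m)%N ->
  (#|[set u : {ffun 'I_n -> 'I_U} * {ffun 'I_n -> 'I_U} |
     [forall j : 'I_k, \sum_i curve_pt (a + m * u.1 i) j == \sum_i curve_pt (a + m * u.2 i) j]%N]|
     <= mean_value k n U)%N.
Proof.
move=> m0; apply: subset_leq_card; apply/fintype.subsetP => [[u u']]; rewrite !inE /=.
move=> /forallP h; apply/forallP => j; apply/eqP.
have hs (v : {ffun 'I_n -> 'I_U}) i : psum i [seq a%:Z + m%:Z * x | x <- [seq (v i : nat)%:Z | i <- enum 'I_n]]
    = (\sum_l (a + m * v l) ^ i)%N%:Z.
  by rewrite -psum_nat -map_comp.
have := @psum_affine a%:Z m%:Z k [seq (u i : nat)%:Z | i <- enum 'I_n] [seq (u' i : nat)%:Z | i <- enum 'I_n].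
rewrite !size_map -lt0n /= => /(_ m0 erefl) H.
have {}H : forall i, (0 < i <= k)%N -> psum i [seq (u i : nat)%:Z | i <- enum 'I_n]
   = psum i [seq (u' i : nat)%:Z | i <- enum 'I_n].
  apply: H => [[|i]] // /andP[_ ik]; rewrite !hs; congr Posz.
  by have /eqP := h (Ordinal ik).
by have /eqP := H j.+1 (ltn_ord j); rewrite !psum_nat => /eqP[].
Qed.

Section Step.
Variables (C : numClosedFieldType) (M : nat) (w : C).
Hypothesis wM : M.-primitive_root w.
Variable k : nat.
Implicit Types (al : {ffun 'I_k -> 'I_M}).
Local Notation curve_sum := (@curve_sum C M w k).
Local Notation fchar := (@fchar C M w k).

Lemma curve_sum_moment_le (n a m U B : nat) : (0 < m)%N -> (0 < B)%N ->
  (forall u, u < U -> a + m * u <= B)%N -> (n * B ^ k < M)%N ->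
  \sum_al `|curve_sum a m U al| ^+ (2 * n) <= M%:R ^+ k * (mean_value k n U)%:R.
Proof.
move=> m0 B0 hB hM.
under eq_bigr do rewrite mulnC exprM -normrX curve_sum_pow.
rewrite (fchar_sum_sqr wM); last first.
  move=> u j; apply: leq_ltn_trans hM.
  apply: (@leq_trans (\sum_(i < n) B ^ k)); last by rewrite sum_nat_const card_ord.
  apply: leq_sum => i _; apply: (@leq_trans (B ^ j.+1)); last by rewrite leq_pexp2l.
  by rewrite leq_exp2r // hB.
by rewrite ler_wpM2l ?exprn_ge0 ?ler0n // ler_nat mean_value_curve_pt_affine.
Qed.

(* The integral of [\prod_i |f_(t i)| ^ 2 |g| ^ (2 s)] is a number of solutions in which the variables
   of the first factors, lying in distinct classes modulo [2 ^ c], satisfy congruences modulo powers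
   of [(2 ^ c) ^ a]. *)
Lemma mixed_moment_le (s c a U U' b : nat) (t : 'I_k -> 'I_(2 ^ c)) :
  let q := ((2 ^ c) ^ a)%N in let P := (2 ^ c * U)%N in
  (0 < a)%N -> injective t -> (0 < P)%N -> (P <= q ^ k)%N -> (P = q * U')%N -> (b < q)%N ->
  ((k + s) * P ^ k < M)%N ->
  \sum_al (\prod_i `|curve_sum (t i) (2 ^ c) U al| ^+ 2) * `|curve_sum b q U' al| ^+ (2 * s) <=
  M%:R ^+ k * (U ^ k * ((\prod_(i < k) q ^ (k - i.+1)) * ((2 ^ c) ^ k.-1) ^ k) * mean_value k s U')%:R.
Proof.
move=> q P a0 tI P0 Pq PU bq hM.
have q0 : (0 < q)%N by rewrite !expn_gt0.
pose X := {ffun 'I_k -> 'I_U}.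
pose Y := {ffun 'I_s -> 'I_U'}.
pose V (x : X) (j : 'I_k) := (\sum_i curve_pt (t i + 2 ^ c * x i) j)%N.
pose W (u : Y) (j : 'I_k) := (\sum_i curve_pt (b + q * u i) j)%N.
have powle (y : nat) (j : 'I_k) : (y <= P)%N -> (curve_pt y j <= P ^ k)%N.
  move=> yP; apply: (@leq_trans (P ^ j.+1)); last by rewrite leq_pexp2l.
  by rewrite leq_exp2r.
have hV x j : (V x j <= k * P ^ k)%N.
  rewrite -[k in (k * _)%N]card_ord -sum_nat_const; apply: leq_sum => i _; apply: powle.
  have := ltn_ord (x i); have := ltn_ord (t i); rewrite /P; nia.
have hW u j : (W u j <= s * P ^ k)%N.
  rewrite -[s in (s * _)%N]card_ord -sum_nat_const; apply: leq_sum => i _; apply: powle.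
  have := ltn_ord (u i); rewrite PU; nia.
have hVW x u j : (V x j + W u j < M)%N.
  by apply: leq_ltn_trans hM; rewrite mulnDl leq_add.
pose G al := `|curve_sum b q U' al| ^+ (2 * s).
have GE al : G al = \sum_(u : Y) \sum_(u' : Y) fchar al (W u) * (fchar al (W u'))^*.
  by rewrite /G mulnC exprM -normrX curve_sum_pow normCK rmorph_sum big_distrlr.
have FE al : \prod_i `|curve_sum (t i) (2 ^ c) U al| ^+ 2 =
   \sum_(x : X) \sum_(x' : X) fchar al (V x) * (fchar al (V x'))^*.
  rewrite prodrXl -normr_prod normCK curve_sum_prod rmorph_sum big_distrlr. 
  by [].
(* Only the first factor is expanded into pairs. The weight [G] is nonnegative, so [D x x'] is at
   most the moment of the second factor; expanding [G] too shows that it vanishes unless [ok x' x],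
   and [card_congruence] bounds the number of such [x] for each [x']. *)
pose D x x' := \sum_al fchar al (V x) * (fchar al (V x'))^* * G al.
have Dle x x' : `|D x x'| <= M%:R ^+ k * (mean_value k s U')%:R.
  apply: (le_trans (ler_norm_sum _ _ _)).
  apply: le_trans (curve_sum_moment_le (B := P) q0 P0 _ _).
  - apply: ler_sum => al _; rewrite !normrM norm_conjC !(norm_fchar wM) !mul1r.
    by rewrite normrX normr_id.
  - by move=> u uU; rewrite PU; nia.
  - by apply: leq_ltn_trans hM; rewrite leq_mul2r leq_addl orbT.
pose ok (x' x : X) := [exists u : Y, [exists u' : Y,
  [forall j, V x j + W u j == V x' j + W u' j]]]%N.
have D0 x x' : ~~ ok x' x -> D x x' = 0.
  move=> nok; rewrite /D.
  transitivity (\sum_(u : Y) \sum_(u' : Y) \sum_al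
     fchar al (fun j => V x j + W u j)%N * (fchar al (fun j => V x' j + W u' j)%N)^*).
    under eq_bigr do rewrite GE mulr_sumr.
    rewrite exchange_big; apply: eq_bigr => u _ /=.
    under eq_bigr do rewrite mulr_sumr.
    rewrite exchange_big; apply: eq_bigr => u' _ /=; apply: eq_bigr => al _.
    by rewrite !fcharD rmorphM; ring.
  rewrite big1 // => u _; rewrite big1 // => u' _; rewrite (fchar_orth wM) //.
  have -> : [forall j, V x j + W u j == V x' j + W u' j]%N = false.
    apply: contraNF nok => h; apply/existsP; exists u; apply/existsP; by exists u'.
  by rewrite mulr0.
rewrite -[leLHS]ger0_norm; last first.
  by apply: sumr_ge0 => al _; rewrite mulr_ge0 ?exprn_ge0 // prodr_ge0 // => i _; rewrite exprn_ge0.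
have -> : \sum_al (\prod_i `|curve_sum (t i) (2 ^ c) U al| ^+ 2) * `|curve_sum b q U' al| ^+ (2 * s)
   = \sum_(x : X) \sum_(x' : X) D x x'.
  rewrite /D; under eq_bigr => al _.
    rewrite FE mulr_suml; under eq_bigr do rewrite mulr_suml.
    over.
  rewrite exchange_big /=; apply: eq_bigr => x _.
  by rewrite exchange_big.
rewrite exchange_big /=.
have card_ok x' : (#|[set x | ok x' x]| <=
   (\prod_(i < k) q ^ (k - i.+1)) * ((2 ^ c) ^ k.-1) ^ k)%N.
  apply: (@card_congruence k c a U (fun i => t i) b%:Z
    [seq (t i + 2 ^ c * x' i)%N%:Z - b%:Z | i <- enum 'I_k]) => //.
    by move=> i j /val_inj /tI.
    by rewrite expnM.
  move=> x; rewrite inE => /existsP[u /existsP[u' /forallP h]].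
  pose sq (v : Y) := [seq (v i : nat)%:Z | i <- enum 'I_s].
  exists (sq u), (sq u').
  (* Translating by [b] turns the variables of the second factor into multiples of [q]. *)
  apply: (@psum_affine b%:Z 1 k) => //.
    by rewrite !size_cat !size_map.
  move=> [//|j] /andP[_ jk].
  have E (y : X) (v : Y) : psum j.+1 [seq b%:Z + 1 * z | z <-
       [seq (t i + 2 ^ c * y i)%N%:Z - b%:Z | i <- enum 'I_k] ++
       [seq ((2 ^ c) ^ a)%N%:Z * z | z <- sq v]] = (V y (Ordinal jk) + W v (Ordinal jk))%N%:Z.
    rewrite map_cat /psum big_cat -/(psum _ _) -/(psum _ _) /= PoszD -!psum_nat.
    congr (psum _ _ + psum _ _); rewrite -!map_comp; apply: eq_map => i /=.
      by rewrite mul1r addrC subrK.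
    by rewrite mul1r -/q PoszD PoszM.
  by rewrite !E; have /eqP -> := h (Ordinal jk).
apply: (@le_trans _ _ (\sum_(x' : X) (M%:R ^+ k * (mean_value k s U')%:R *
     ((\prod_(i < k) q ^ (k - i.+1)) * ((2 ^ c) ^ k.-1) ^ k)%:R))).
  apply: (le_trans (ler_norm_sum _ _ _)); apply: ler_sum => x' _.
  apply: (le_trans (ler_norm_sum _ _ _)).
  apply: (@le_trans _ _ (\sum_(x in [set x | ok x' x]) M%:R ^+ k * (mean_value k s U')%:R)).
    rewrite [leRHS]big_mkcond; apply: ler_sum => x _; rewrite inE; case: ifPn => [_|/D0 ->] //.
    by rewrite normr0.
  by rewrite sumr_const -[leLHS]mulr_natr ler_wpM2l ?mulr_ge0 ?exprn_ge0 ?ler0n // ler_nat.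
rewrite sumr_const card_ffun !card_ord -mulr_natl !natrM.
by rewrite le_eqVlt; apply/orP; left; apply/eqP; ring.
Qed.
End Step.

(** The two terms are the two cases of [sum_pow_le_distinct] for the classes modulo [p]. If few
    classes dominate, [n] stays and the range shrinks by [p]. Otherwise [k] distinct classes take
    part and [mixed_moment_le] applies, after Hölder's inequality has cut each class modulo [p] of
    the remaining factor into [r] classes modulo [p ^ a]. *)
Lemma mean_value_step (k s c a r U U' : nat) :
  let p := (2 ^ c)%N in let n := (s + k)%N in
  (0 < k)%N -> (0 < s)%N -> (0 < a)%N -> (0 < U)%N -> (p * U <= (p ^ a) ^ k)%N ->
  U = (r * U')%N -> (p ^ a = p * r)%N ->
  (mean_value k n (p * U) <= (2 * k) ^ (2 * n) * p * mean_value k n U +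
     (2 * p) ^ (2 * n) * (p ^ k * (r ^ (2 * s).-1 * (p ^ a *
     (U ^ k * ((\prod_(i < k) (p ^ a) ^ (k - i.+1)) * (p ^ k.-1) ^ k) * mean_value k s U')))))%N.
Proof.
move=> p n k0 s0 a0 U0 hP hU hr.
have p0 : (0 < p)%N by rewrite expn_gt0.
have P0 : (0 < p * U)%N by rewrite muln_gt0 p0.
pose M := (n * (p * U) ^ k).+1.
have [w wM] := C_prim_root_exists (ltn0Sn _ : (0 < M)%N).
have M0 : 0 < M%:R ^+ k :> algC by rewrite exprn_gt0 // ltr0n.
pose f a m V al := @curve_sum _ M w k a m V al.
have E : \sum_al `|f 0 1 (p * U) al| ^+ (2 * n) = M%:R ^+ k * (mean_value k n (p * U))%:R.
  under eq_bigr do rewrite mulnC exprM -normrX /f curve_sum_pow.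
  rewrite (fchar_sum_sqr wM); last first.
    move=> u j; rewrite ltnS.
    apply: (@leq_trans (\sum_(i < n) (p * U) ^ k)); last by rewrite sum_nat_const card_ord.
    apply: leq_sum => i _; apply: (@leq_trans ((p * U) ^ j.+1)); last by rewrite leq_pexp2l.
    by rewrite leq_exp2r // add0n mul1n ltnW.
  congr (_ * _%:R); apply: eq_card => u; rewrite !inE; apply: eq_forallb => j.
  by congr (_ == _); apply: eq_bigr => i _; rewrite /curve_pt add0n mul1n.
have pw al : `|f 0 1 (p * U) al| ^+ (2 * n) <=
   (2 * k)%:R ^+ (2 * n) * \sum_(b < p) `|f b p U al| ^+ (2 * n) +
   (2 * p)%:R ^+ (2 * n) * \sum_(t : {ffun 'I_k -> 'I_p} | injectiveb t)
      (\prod_i `|f (t i) p U al| ^+ 2) * \sum_(b < p) `|f b p U al| ^+ (2 * s).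
  have z0 (b : 'I_p) : 0 <= `|f b p U al| by [].
  apply: le_trans (@sum_pow_le_distinct algC p k s _ k0 z0).
  rewrite lerXn2r ?nnegrE ?sumr_ge0 // /f curve_sum_split.
  under eq_bigr do rewrite add0n !mul1n.
  exact: ler_norm_sum.
have split_b (b : 'I_p) al : `|f b p U al| ^+ (2 * s) <=
   r%:R ^+ (2 * s).-1 * \sum_(l < r) `|f (b + p * l)%N (p ^ a)%N U' al| ^+ (2 * s).
  have e : (2 * s = (2 * s).-1.+1)%N by lia.
  rewrite /f hU curve_sum_split -hr.
  apply: (@le_trans _ _ ((\sum_(l < r) `|f (b + p * l)%N (p ^ a)%N U' al|) ^+ (2 * s))).
    by rewrite lerXn2r ?nnegrE ?sumr_ge0 //; apply: ler_norm_sum.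
  have := @power_mean algC 'I_r [set: 'I_r] (fun l => `|f (b + p * l)%N (p ^ a)%N U' al|) (2 * s).-1.
  have eT (F : 'I_r -> algC) : \sum_(l in [set: 'I_r]) F l = \sum_l F l by apply: eq_bigl => l; rewrite inE.
  rewrite -e cardsT card_ord !eT.
  by apply=> i _.
pose B := (M%:R ^+ k * (U ^ k * ((\prod_(i < k) (p ^ a) ^ (k - i.+1)) * (p ^ k.-1) ^ k) * mean_value k s U')%:R : algC).
have B0 : 0 <= B by rewrite mulr_ge0 ?ler0n // ltW.
have mixed (t : {ffun 'I_k -> 'I_p}) (b : 'I_p) (l : 'I_r) : injectiveb t ->
  \sum_al (\prod_i `|f (t i) p U al| ^+ 2) * `|f (b + p * l)%N (p ^ a)%N U' al| ^+ (2 * s) <= B.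
  move=> /injectiveP tI; apply: (mixed_moment_le wM) => //.
  - by rewrite hU mulnA hr.
  - rewrite -/p hr; have := ltn_ord b; have := ltn_ord l; nia.
  - by rewrite ltnS leq_mul2r /n addnC leqnn orbT.
have first_le : \sum_al \sum_(b < p) `|f b p U al| ^+ (2 * n) <= p%:R * (M%:R ^+ k * (mean_value k n U)%:R).
  rewrite exchange_big /= -[p in leRHS]card_ord mulr_natl -sumr_const; apply: ler_sum => b _.
  apply: (curve_sum_moment_le wM (B := (p * U)%N)) => //.
  by move=> u uU; have := ltn_ord b; nia.
have second_le : \sum_al \sum_(t : {ffun 'I_k -> 'I_p} | injectiveb t)
      (\prod_i `|f (t i) p U al| ^+ 2) * \sum_(b < p) `|f b p U al| ^+ (2 * s) <=
   (p ^ k)%:R * (r%:R ^+ (2 * s).-1 * ((p ^ a)%:R * B)).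
  rewrite exchange_big /=.
  have -> : (p ^ k)%:R = #|{ffun 'I_k -> 'I_p}|%:R :> algC by rewrite card_ffun !card_ord.
  rewrite mulr_natl -sumr_const big_mkcond; apply: ler_sum => t _.
  case: ifP => tI; last by rewrite !mulr_ge0 ?exprn_ge0 ?ler0n.
  apply: (@le_trans _ _ (\sum_al (\prod_i `|f (t i) p U al| ^+ 2) * \sum_(b < p)
     (r%:R ^+ (2 * s).-1 * \sum_(l < r) `|f (b + p * l)%N (p ^ a)%N U' al| ^+ (2 * s)))).
    apply: ler_sum => al _; apply: ler_wpM2l; last by apply: ler_sum.
    by apply: prodr_ge0 => i _; rewrite exprn_ge0.
  under eq_bigr do rewrite -mulr_sumr mulrCA.
  rewrite -mulr_sumr ler_wpM2l ?exprn_ge0 ?ler0n //.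
  under eq_bigr do rewrite pair_big mulr_sumr.
  rewrite exchange_big /=.
  have -> : (p ^ a)%:R * B = \sum_(bl : 'I_p * 'I_r) B.
    by rewrite sumr_const card_prod !card_ord -hr mulr_natl.
  by apply: ler_sum => -[b l] _; apply: mixed.
rewrite -(ler_nat algC) -(ler_pM2l M0) -E.
apply: (le_trans (ler_sum _ (fun al _ => pw al))).
rewrite big_split /= -!mulr_sumr.
apply: (le_trans (lerD (ler_wpM2l _ first_le) (ler_wpM2l _ second_le))).
- by rewrite exprn_ge0 ?ler0n.
- by rewrite exprn_ge0 ?ler0n.
rewrite /B !(natrD, natrM, natrX) le_eqVlt; apply/orP; left; apply/eqP.
by ring.
Qed.

(** * Iteration of the mean value recursion *)

Local Open Scope nat_scope.

Lemma prod_exp_rev (q k : nat) : \prod_(i < k) q ^ (k - i.+1) = q ^ 'C(k, 2).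
Proof.
rewrite -expn_sum (reindex_inj rev_ord_inj) /=; congr (_ ^ _).
rewrite -bin2_sum big_mkord; apply: eq_bigr => i _ /=.
have := ltn_ord i; lia.
Qed.

Lemma bin2_double k : 2 * 'C(k, 2) = k * k.-1.
Proof. by elim: k => // k IH; rewrite binS bin1 /= mulnDr IH; case: k {IH} => //= k; lia. Qed.

Lemma bin2_add k : 'C(k.+1, 2) + 'C(k, 2) = k * k.
Proof.
have := bin2_double k; rewrite binS bin1; case: k => // k /=; nia.
Qed.

(** With every length a power of [p] the recursion becomes one on exponents; [(2 * k) ^ 2 <= p]
    serves to absorb all numerical constants into powers of [p]. *)
Lemma mean_value_step_pow (k s c a b : nat) :
  let p := 2 ^ c in let n := s + k in
  0 < k -> 0 < s -> 0 < a <= b -> b <= a * k -> (2 * k) ^ 2 <= p ->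
  mean_value k n (p ^ b) <= p ^ n.+1 * mean_value k n (p ^ b.-1) +
    p ^ (2 * s * a + b * k + a * 'C(k, 2) + s + 2 * k + k ^ 2 + 1) * mean_value k s (p ^ (b - a)).
Proof.
move=> p n k0 s0 /andP[a0 ab] bak kp.
have p0 : 0 < p by rewrite expn_gt0.
have p4 : 4 <= p by apply: leq_trans kp; nia.
have b0 : 0 < b by lia.
have -> : p ^ b = p * p ^ b.-1 by rewrite -expnS prednK.
apply: (leq_trans (@mean_value_step k s c a (p ^ a.-1) (p ^ b.-1) (p ^ (b - a)) k0 s0 a0 _ _ _ _)).
- by rewrite expn_gt0 p0.
- by rewrite -expnS prednK // -[((2 ^ c) ^ a) ^ k]expnM leq_pexp2l // p0.
- by rewrite -expnD; congr (_ ^ _); lia.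
- by rewrite -expnS prednK.
rewrite -/p -/n leq_add //.
  have h1 : (2 * k) ^ (2 * n) <= p ^ n by rewrite expnM leq_exp2r // /n addn_gt0 s0.
  by rewrite leq_mul // [p ^ n.+1]expnSr leq_mul.
have h2p : (2 * p) ^ (2 * n) <= p ^ (3 * n).
  rewrite expnMn expnM (mulSn 2) expnD leq_mul // leq_exp2r //.
  by rewrite /n addn_gt0 s0.
apply: (@leq_trans (p ^ (3 * n) * (p ^ k * ((p ^ a.-1) ^ (2 * s).-1 * (p ^ a * (
    (p ^ b.-1) ^ k * ((p ^ a) ^ 'C(k, 2) * (p ^ k.-1) ^ k) * mean_value k s (p ^ (b - a)))))))).
  by rewrite prod_exp_rev leq_mul.
rewrite !mulnA leq_mul // -!expnM -!expnD leq_pexp2l // /n.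
move: 'C(k, 2) => t; clear -k0 s0 a0 b0.
case: a a0 => // a _; case: b b0 => // b _; case: k k0 => // k _; case: s s0 => // s _.
have -> : (2 * s.+1).-1 = (2 * s).+1 by lia.
rewrite /= -!mulnn; nia.
Qed.

(** The quotient is the ceiling of b/k, the least [a] with [p ^ b <= (p ^ a) ^ k]; what remains is
    the exponent of the range after passing to a class modulo [p ^ a]. *)
Definition shrink (k b : nat) : nat := b - (b + k.-1) %/ k.

Lemma leq_shrink k : 0 < k -> {homo shrink k : b b' / b <= b'}.
Proof.
move=> k0; apply: homo_leq => //; first exact: leq_trans.
move=> b; rewrite /shrink.
have := leq_div2r k (_ : b + k.-1 <= b.+1 + k.-1); rewrite leq_add2r leqnSn => /(_ isT).
have : (b.+1 + k.-1) %/ k <= ((b + k.-1) + k) %/ k by apply: leq_div2r; lia.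
rewrite [(b + k.-1 + k) %/ k]divnDr ?dvdnn // divnn k0 /=; lia.
Qed.

Lemma leq_iter_shrink k l : 0 < k -> {homo iter l (shrink k) : b b' / b <= b'}.
Proof. by move=> k0; elim: l => // l IH b b' bb' /=; apply: leq_shrink => //; apply: IH. Qed.

Lemma shrink_bound k l b : 0 < k -> iter l (shrink k) b * k ^ l <= b * k.-1 ^ l.
Proof.
move=> k0; elim: l b => [|l IH] b; first by rewrite !expn0.
have h : shrink k b * k <= b * k.-1.
  rewrite /shrink mulnBl; have := ltn_ceil (b + k.-1) k0; nia.
rewrite iterSr !expnS [k * _]mulnC !mulnA.
apply: (@leq_trans (shrink k b * k.-1 ^ l * k)); first by rewrite leq_mul2r IH orbT.
by rewrite mulnAC leq_mul2r h orbT.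
Qed.

Lemma mean_value_le_triv k n U : mean_value k n U <= U ^ (2 * n).
Proof.
apply: leq_trans (max_card _) _.
by rewrite card_prod card_ffun !card_ord -expnD addnn mul2n.
Qed.

(** For P = p^b this is the bound P^(2n - K), up to the displayed loss in which [b] has been shrunk
    [l] times; [l = 0] is the trivial bound. The outer induction on [l] handles the second term of
    the recursion, where [n] drops by [k]; an inner one on [b] handles the first, where [n] stays
    and [b] drops by one. *)
Lemma mean_value_bound (k c l b : nat) :
  let p := 2 ^ c in let K := 'C(k.+1, 2) in let n := k ^ 2 + k * l in
  1 < k -> (2 * k) ^ 2 <= p ->
  mean_value k n (p ^ b) * p ^ (b * K) <=
  p ^ (2 * n * b + K * iter l (shrink k) b + l * (n + 2 * k ^ 2 + 2)).
Proof.
move=> p K n k1 kp; rewrite {}/n.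
have k0 : 0 < k by lia.
have p0 : 0 < p by rewrite expn_gt0.
have p2 : 2 <= p by nia.
have KE : K = 'C(k, 2) + k by rewrite /K binS bin1.
have K2 : 2 * K = k * k.+1 by rewrite /K bin2_double mulnC.
elim: l b => [|l IH] b.
  rewrite muln0 addn0 mul0n addn0 /= [K * b]mulnC expnD leq_mul2r; apply/orP; right.
  by rewrite [2 * _ * b]mulnC expnM; apply: mean_value_le_triv.
set s := k ^ 2 + k * l in IH *.
have -> : k ^ 2 + k * l.+1 = s + k by rewrite mulnS; lia.
set E := l.+1 * _.
have sk : k ^ 2 <= s by apply: leq_addr.
have kk : k ^ 2 = k * k by rewrite -mulnn.
have nK : K + 2 <= s + k by nia.
elim: b => [|b IHb].
  rewrite mul0n !expn0 muln1 (leq_trans (mean_value_le_triv _ _ _)) // exp1n expn_gt0 p0 //.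
pose a := (b.+1 + k.-1) %/ k.
have a1 : a * k <= b.+1 + k.-1 by apply: leq_divM.
have a2 : b.+1 + k.-1 < a.+1 * k by apply: ltn_ceil.
have a0 : 0 < a by rewrite divn_gt0 //; lia.
have ab : a <= b.+1.
  rewrite -(leq_pmul2r k0) (leq_trans a1) // mulSn [k + _]addnC.
  have := leq_pmulr b k0; lia.
have bak : b.+1 <= a * k by rewrite mulSn in a2; lia.
have st := @mean_value_step_pow k s c a b.+1 k0 _ _ bak kp.
have {}st := st _ _.
rewrite /= -/p in st.
have s0 : 0 < s by apply: leq_trans sk; rewrite expn_gt0 k0.
have {}st := st s0 (introT andP (conj a0 ab)).
set X := K * iter l.+1 (shrink k) b.+1.
have XX : K * iter l.+1 (shrink k) b <= X by rewrite leq_mul2l leq_iter_shrink ?orbT.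
set Z := 2 * (s + k) * b.+1 + X + E.
have Z0 : 0 < Z by rewrite /Z /E addn_gt0 muln_gt0 addnS !orbT.
(* Both terms are kept below [p ^ Z.-1], so that the spare factor [p], at least 2, absorbs their
   sum. Here the shorter range saves 2(s + k) in the exponent against a loss of s + k + 1 + K, and
   [nK] leaves the spare unit. *)
have h1 : p ^ (s + k).+1 * mean_value k (s + k) (p ^ b) * p ^ (b.+1 * K) <= p ^ Z.-1.
  have -> : p ^ (s + k).+1 * mean_value k (s + k) (p ^ b) * p ^ (b.+1 * K) =
    p ^ ((s + k).+1 + K) * (mean_value k (s + k) (p ^ b) * p ^ (b * K)).
    by rewrite mulSn !expnD; ring.
  apply: (leq_trans (leq_mul (leqnn _) IHb)).
  by rewrite -expnD leq_pexp2l // /Z mulnS; move: XX nK; clear; lia.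
have h2 : p ^ (2 * s * a + b.+1 * k + a * 'C(k, 2) + s + 2 * k + k ^ 2 + 1) *
    mean_value k s (p ^ (b.+1 - a)) * p ^ (b.+1 * K) <= p ^ Z.-1.
  have eb : b.+1 = a + shrink k b.+1 by rewrite /shrink subnKC.
  have -> : b.+1 * K = a * K + shrink k b.+1 * K by rewrite {1}eb mulnDl.
  have -> : b.+1 - a = shrink k b.+1 by [].
  set w := 2 * s * a + _ + _ + _ + _ + _ + _.
  have -> : p ^ w * mean_value k s (p ^ shrink k b.+1) * p ^ (a * K + shrink k b.+1 * K) =
    p ^ (w + a * K) * (mean_value k s (p ^ shrink k b.+1) * p ^ (shrink k b.+1 * K)).
    by rewrite !expnD; ring.
  apply: (leq_trans (leq_mul (leqnn _) (IH (shrink k b.+1)))).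
  rewrite -expnD leq_pexp2l // -iterSr -/X /Z.
  (* The powers of [q = p ^ a] add up to a(K + k(k-1)/2) = a k^2, which rounding [a] up makes larger
     than [b.+1 * k] by at most k(k-1). *)
  have h3 : w + a * K + 2 * s * shrink k b.+1 + 1 <= 2 * (s + k) * b.+1 + (s + k + 2 * k ^ 2 + 2).
    have -> : w = 2 * s * a + b.+1 * k + a * 'C(k, 2) + s + 2 * k + k ^ 2 + 1 by [].
    have e2 : 2 * s * b.+1 = 2 * s * a + 2 * s * shrink k b.+1 by rewrite {1}eb mulnDr.
    have e3 : a * K + a * 'C(k, 2) <= b.+1 * k + k * k.-1.
      rewrite -mulnDr bin2_add mulnA (leq_trans (leq_mul a1 (leqnn k))) //.
      by rewrite mulnDl [k.-1 * k]mulnC.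
    have e4 : k * k.-1 + k = k * k by rewrite -mulnSr prednK.
    have -> : 2 * (s + k) * b.+1 = 2 * s * b.+1 + 2 * (b.+1 * k) by ring.
    rewrite e2 kk; move: e3 e4; clear.
    move: (a * K) (a * _) (b.+1 * k) (k * _) (k * k) (2 * s * a) (2 * s * _) => *; lia.
  have -> : E = l * (s + 2 * k ^ 2 + 2) + l * k + (s + k + 2 * k ^ 2 + 2).
    by rewrite /E mulSn; ring.
  move: h3; clear; move: (2 * s * _) (2 * (s + k) * _) (l * _) (l * _) (_ + 2) (a * K) => *; lia.
apply: (leq_trans (leq_mul st (leqnn _))).
rewrite mulnDl (leq_trans (leq_add h1 h2)) // addnn -mul2n.
by rewrite -[in leqRHS](prednK Z0) expnS leq_mul2r p2 orbT.
Qed.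

Local Open Scope ring_scope.

(** * Short sums of primitive characters *)

Lemma common_prime (m n : nat) : (0 < n)%N -> ~~ coprime m n ->
  exists p, [/\ prime p, (p %| m)%N & (p %| n)%N].
Proof.
move=> n0 h; have g1 : (1 < gcdn m n)%N.
  by rewrite ltn_neqAle eq_sym h gcdn_gt0 n0 orbT.
exists (pdiv (gcdn m n)); rewrite pdiv_prime //; split=> //;
  by rewrite (dvdn_trans (pdiv_dvd _)) ?dvdn_gcdl ?dvdn_gcdr.
Qed.

(** Take for [t] the product of the primes of [q] not dividing [n]: each prime of [q] then divides
    exactly one of [n] and [d * t]. *)
Lemma coprime_lift (q d n : nat) : (0 < q)%N -> coprime n d ->
  exists t : nat, coprime (n + d * t) q.
Proof.
move=> q0 cnd; pose t := (\prod_(p <- primes q | ~~ (p %| n)) p)%N.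
exists t; apply: contraT => /(common_prime q0)[p [pp pnt pq]].
have [pn|pn] := boolP (p %| n)%N; last first.
  have pt : (p %| d * t)%N.
    rewrite dvdn_mull // /t -big_filter (bigD1_seq p) ?filter_uniq ?primes_uniq //= ?dvdn_mulr //.
    by rewrite mem_filter pn mem_primes pp q0.
  by move: pnt; rewrite dvdn_addl // (negbTE pn).
move: pnt; rewrite dvdn_addr // Euclid_dvdM //.
case/orP => [pd|].
  have : (p %| gcdn n d)%N by rewrite dvdn_gcd pn.
  by rewrite (eqP cnd) dvdn1; case/primeP: pp => + _ => /[swap]/eqP ->.
rewrite Euclid_dvd_prod // -big_filter big_has => /hasP[p'].
rewrite mem_filter mem_primes => /andP[p'n /and3P[pp' _ _]].
by rewrite dvdn_prime2 // => /eqP e; rewrite -e pn in p'n.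
Qed.

Section Characters.
Variables (R : realType) (q : nat) (chi : dirichlet_character R q).

Let q0 : (0 < q)%N := modulus_gt0 chi.

Lemma chi_congr (m n : int) : (q%:Z %| m - n)%Z -> chi m = chi n.
Proof.
have step (t : nat) (x : int) : chi (x + t%:Z * q%:Z) = chi x.
  elim: t x => [|t IH] x; first by rewrite mul0r addr0.
  by rewrite intS mulrDl mul1r addrA IH dirichlet_periodic.
move=> /dvdzP[t e].
have -> : m = n + t * q%:Z by rewrite -e addrC subrK.
case: t {e} => t; first exact: step.
by rewrite NegzE mulNr -[in RHS](subrK (t.+1%:Z * q%:Z) n) step.
Qed.

Lemma chi_eq0 n : ~~ coprimez n q%:Z -> chi n = 0.
Proof. by apply: contraNeq; rewrite dirichlet_support. Qed.

Lemma chi_neq0 n : coprimez n q%:Z -> chi n != 0.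
Proof. by rewrite dirichlet_support. Qed.

Lemma chi1 : chi 1 = 1.
Proof.
have h : chi 1 != 0 by rewrite chi_neq0 // coprimezE coprime1n.
by apply: (mulfI h); rewrite -dirichlet_multiplicative !mulr1.
Qed.

Lemma chiX n m : chi (n ^+ m) = chi n ^+ m.
Proof. by elim: m => [|m IH]; rewrite ?expr0 ?chi1 // !exprS dirichlet_multiplicative IH. Qed.

Lemma chi_prod (I : Type) (r : seq I) (F : I -> int) :
  chi (\prod_(i <- r) F i) = \prod_(i <- r) chi (F i).
Proof. exact: (big_morph chi (@dirichlet_multiplicative _ _ chi) chi1). Qed.

Lemma inverse_mod (n : int) : coprimez n q%:Z -> exists m : int, (q%:Z %| n * m - 1)%Z.
Proof.
move=> /coprimezP[[u v] /= e]; exists u.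
by rewrite -e opprD addrA mulrC subrr sub0r -mulNr dvdz_mull.
Qed.

Lemma chi_norm n : coprimez n q%:Z -> `|chi n| = 1.
Proof.
move=> cn.
have cn' : coprime `|(n %% q%:Z)%Z|%N q.
  have : coprimez (n %% q%:Z)%Z q%:Z by rewrite /coprimez gcdz_modl.
  by rewrite coprimezE.
have e : chi (n ^+ totient q) = 1.
  rewrite -chi1; apply: chi_congr; rewrite -eqz_mod_dvd.
  have en : (n = `|(n %% q%:Z)%Z|%N %[mod q])%Z.
    rewrite gez0_abs ?modz_mod // modz_ge0 // -lt0n; exact: q0.
  rewrite -modzXm en modzXm -rmorphXn !modz_nat (Euler_exp_totient cn').
  by [].
have t0 : (0 < totient q)%N by rewrite totient_gt0.
apply/eqP; rewrite -(@pexpr_eq1 _ _ (totient q)) // -normrX -chiX e normr1.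
by [].
Qed.

Lemma chi_norm_le1 n : `|chi n| <= 1.
Proof.
have [/chi_norm ->//|/chi_eq0 ->] := boolP (coprimez n q%:Z).
by rewrite normr0 ler01.
Qed.

Lemma chi_eq_of_trivial (d : nat) : (d %| q)%N ->
  (forall m : int, coprimez m q%:Z -> (d%:Z %| m - 1)%Z -> chi m = 1) ->
  forall a b : int, coprimez a q%:Z -> coprimez b q%:Z -> (d%:Z %| a - b)%Z -> chi a = chi b.
Proof.
move=> dq h a b ca cb dab.
have [b' hb'] := inverse_mod cb.
have cb' : coprimez b' q%:Z.
  have : chi (b * b') = 1 by rewrite -chi1; apply: chi_congr.
  move=> e; apply: contraT => /chi_eq0 e0; move: e.
  by rewrite dirichlet_multiplicative e0 mulr0 => /esym/eqP; rewrite oner_eq0.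
have e1 : chi (a * b') = 1.
  apply: h; first by rewrite coprimezMl ca.
  have -> : a * b' - 1 = (a - b) * b' + (b * b' - 1) by ring.
  by rewrite rpredD ?dvdz_mulr // (dvdz_trans _ hb') // dvdzE.
have e2 : chi (b * b') = 1 by rewrite -chi1; apply: chi_congr.
apply: (mulIf (chi_neq0 cb')).
by rewrite -!dirichlet_multiplicative e1 e2.
Qed.

(** The definition of primitivity asks for a genuine character modulo [d]. It is obtained by
    evaluating [chi] at a lift coprime to [q], and triviality on the classes 1 modulo [d] makes this
    independent of the lift. *)
Lemma primitive_modulus (d : nat) : primitive_character chi -> (d %| q)%N ->
  (forall m : int, coprimez m q%:Z -> (d%:Z %| m - 1)%Z -> chi m = 1) -> d = q.
Proof.
move=> prim dq /(chi_eq_of_trivial dq) h; apply: prim => //.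
have d0 : (0 < d)%N by apply: dvdn_gt0 dq.
have dZ : d%:Z != 0 by rewrite -lt0n.
have lift_ex (n : int) : exists m : int, coprimez n d%:Z -> coprimez m q%:Z /\ (d%:Z %| m - n)%Z.
  have [cn|] := boolP (coprimez n d%:Z); last by exists 0.
  have cn' : coprime `|(n %% d%:Z)%Z|%N d.
    have : coprimez (n %% d%:Z)%Z d%:Z by rewrite /coprimez gcdz_modl.
    by rewrite coprimezE.
  have [t ht] := coprime_lift q0 cn'.
  exists ((`|(n %% d%:Z)%Z| + d * t)%N%:Z) => _; split; first by rewrite coprimezE.
  rewrite PoszD PoszM gez0_abs ?modz_ge0 // -addrAC.
  rewrite rpredD ?dvdz_mulr // -eqz_mod_dvd modz_mod //.
have [lift hlift] := choice lift_ex.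
pose f (n : int) : R[i] := if coprimez n d%:Z then chi (lift n) else 0.
have fE n m : coprimez n d%:Z -> coprimez m q%:Z -> (d%:Z %| m - n)%Z -> f n = chi m.
  move=> cn cm dm; rewrite /f cn; have [c1 c2] := hlift n cn.
  by apply: h => //; rewrite -[lift n](subrK n) -addrA rpredD // -opprB rpredN.
have f_per n : f (n + d%:Z) = f n.
  have e : coprimez (n + d%:Z) d%:Z = coprimez n d%:Z by rewrite addrC coprimez_sym [RHS]coprimez_sym /coprimez gcdzDl.
  have [cn|ncn] := boolP (coprimez n d%:Z); last by rewrite /f e (negbTE ncn).
  have [c1 c2] := hlift n cn.
  rewrite (fE (n + d%:Z) (lift n)) ?e // ?(fE n (lift n)) //.
  by rewrite opprD addrA rpredB.
have f_mul : {morph f : m n / m * n}.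
  move=> m n; rewrite {2 3}/f.
  have [cm|ncm] := boolP (coprimez m d%:Z); last by rewrite /f coprimezMl (negbTE ncm) mul0r.
  have [cn|ncn] := boolP (coprimez n d%:Z); last by rewrite /f coprimezMl (negbTE ncn) andbF mulr0.
  have [c1 c2] := hlift m cm; have [c3 c4] := hlift n cn.
  rewrite -dirichlet_multiplicative; apply: fE; rewrite ?coprimezMl ?cm ?c1 //.
  have -> : lift m * lift n - m * n = (lift m - m) * lift n + m * (lift n - n) by ring.
  by rewrite rpredD ?(dvdz_mulr _ c2) ?(dvdz_mull _ c4).
have f_supp n : (f n != 0) = coprimez n d%:Z.
  rewrite /f; case: ifP => cn; last by rewrite eqxx.
  by have [c1 c2] := hlift n cn; rewrite chi_neq0.
exists (DirichletCharacter d0 f_per f_mul f_supp) => n cn /=.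
rewrite (fE n n) ?subrr ?dvdz0 //.
exact: coprimez_dvdr dq cn.
Qed.

(** By Bezout, every integer congruent to 1 modulo gcd(g, q) is congruent modulo [q] to some
    [1 + g * h], so [chi] is trivial on that class and the gcd must be [q]. *)
Lemma primitive_dvd (g : int) : primitive_character chi ->
  (forall h : int, chi (1 + g * h) = 1) -> (q%:Z %| g)%Z.
Proof.
move=> prim hg.
pose d := `|gcdz g q%:Z|%N.
have dE : d%:Z = gcdz g q%:Z by rewrite gez0_abs.
have dq : (d %| q)%N by have := dvdz_gcdr g q%:Z; rewrite dvdzE.
suff <- : d = q by rewrite dE dvdz_gcdl.
apply: primitive_modulus => // m cm; rewrite dE => /dvdzP[j e].
have [u v [e2 _]] := egcdzP g q%:Z.
rewrite -(hg (u * j)); apply: chi_congr.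
have -> : m = 1 + j * (u * g + v * q%:Z) by rewrite e2 -e addrC subrK.
apply/dvdzP; exists (j * v); ring.
Qed.
End Characters.

(** * Bessel's inequality and orthogonal vectors of character values *)

Lemma bessel (C : numClosedFieldType) (T L : finType) (Phi : T -> L -> C) (N : C) (c : L -> C) :
  0 < N ->
  (forall t t', \sum_l Phi t l * (Phi t' l)^* = N * (t == t')%:R) ->
  \sum_t `|\sum_l c l * Phi t l| ^+ 2 <= N * \sum_l `|c l| ^+ 2.
Proof.
move=> N0 orth; have NJ : N^* = N by apply: geC0_conj; exact: ltW.
pose a t := \sum_l c l * Phi t l.
pose S := \sum_t `|a t| ^+ 2.
have e1 : \sum_l (N * c l) * (\sum_t a t * (Phi t l)^*)^* = N * S.
  under eq_bigr do rewrite rmorph_sum mulr_sumr.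
  rewrite exchange_big /= /S mulr_sumr; apply: eq_bigr => t _.
  transitivity (N * (a t)^* * \sum_l c l * Phi t l).
    by rewrite mulr_sumr; apply: eq_bigr => l _; rewrite rmorphM /= conjCK; ring.
  by rewrite normCK -/(a t); ring.
have e2 : \sum_l (\sum_t a t * (Phi t l)^*) * (N * c l)^* = N * S.
  rewrite -[RHS]conjCK rmorphM /= NJ /S rmorph_sum.
  have -> : \sum_t (`|a t| ^+ 2)^* = S.
    by apply: eq_bigr => t _; rewrite rmorphXn /= conj_Creal.
  rewrite -e1 rmorph_sum; apply: eq_bigr => l _.
  by rewrite !rmorphM /= conjCK mulrC.
have e3 : \sum_l (\sum_t a t * (Phi t l)^*) * (\sum_t a t * (Phi t l)^*)^* = N * S.
  under eq_bigr do rewrite rmorph_sum big_distrlr.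
  rewrite exchange_big /= /S mulr_sumr; apply: eq_bigr => t _.
  rewrite exchange_big /= (bigD1 t) //= [X in _ + X]big1 ?addr0 => [|t' t't].
    under eq_bigr => l _ do rewrite rmorphM /= conjCK.
    transitivity (a t * (a t)^* * \sum_l Phi t l * (Phi t l)^*).
      by rewrite mulr_sumr; apply: eq_bigr => l _; ring.
    by rewrite orth eqxx mulr1 normCK mulrC.
  under eq_bigr => l _ do rewrite rmorphM /= conjCK.
  transitivity (a t * (a t')^* * \sum_l Phi t' l * (Phi t l)^*).
    by rewrite mulr_sumr; apply: eq_bigr => l _; ring.
  by rewrite orth (negbTE t't) !mulr0.
(* The squared distance from [N * c] to its expansion along the orthogonal family is nonnegative. *)
have : 0 <= \sum_l `|N * c l - \sum_t a t * (Phi t l)^*| ^+ 2.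
  by apply: sumr_ge0 => l _; rewrite exprn_ge0.
under eq_bigr do rewrite normCK rmorphB mulrBl !mulrBr.
rewrite !sumrB e1 e2 e3 subrr subr0.
have -> : \sum_l (N * c l) * (N * c l)^* = N * (N * \sum_l `|c l| ^+ 2).
  by rewrite !mulr_sumr; apply: eq_bigr => l _; rewrite rmorphM /= NJ normCK; ring.
by rewrite -mulrBr pmulr_rge0 // subr_ge0.
Qed.

Section Orthogonality.
Variables (R : realType) (q : nat) (chi : dirichlet_character R q).
Hypothesis prim : primitive_character chi.
Let q0 : (0 < q)%N := modulus_gt0 chi.

Lemma coprime_mod_radical (e m : nat) (x n : int) :
  (q %| e ^ m)%N -> (e%:Z %| x - n)%Z -> coprimez n q%:Z -> coprimez x q%:Z.
Proof.
move=> qe exn; apply: contraLR; rewrite !coprimezE /= => /(common_prime q0)[p [pp px pq]].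
have pe : (p%:Z %| e%:Z)%Z.
  rewrite dvdzE /=; have := dvdn_trans pq qe.
  by rewrite Euclid_dvdX // => /andP[].
have pn : (p %| `|n|)%N.
  have : (p%:Z %| n)%Z.
    by rewrite -[n](subKr x) rpredB ?(dvdz_trans pe exn) // unfold_in /= dvdzE.
  by rewrite dvdzE.
have : (p %| gcdn `|n| q)%N by rewrite dvdn_gcd pn.
apply: contraL => /eqP ->.
by rewrite dvdn1; apply: contraTN pp => /eqP ->.
Qed.

(** Since [d] divides [A - n ^ s] and [q] divides [d ^ k.+1], raising [l] by one multiplies the
    argument by 1 + m^k d^k modulo [q], with [m] inverse to [n]. The sum is thus geometric; it runs
    over whole periods, as [l] matters only modulo [d], and it vanishes when the ratio is not 1. *)
Lemma sum_char_orth (k s d W : nat) (n n' A A' : int) :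
  (0 < k <= s)%N -> (q %| d ^ k.+1)%N ->
  coprimez n q%:Z -> coprimez n' q%:Z ->
  (d%:Z %| A - n ^+ s)%Z -> (d%:Z %| A' - n' ^+ s)%Z ->
  ~~ (q%:Z %| d%:Z ^+ k * (n ^+ k - n' ^+ k))%Z ->
  \sum_(l < d * W) chi (A + n ^+ (s - k) * d%:Z ^+ k * (l : nat)%:Z) *
     (chi (A' + n' ^+ (s - k) * d%:Z ^+ k * (l : nat)%:Z))^* = 0.
Proof.
move=> /andP[k0 ks] qd cn cn' dA dA' nq.
have qd' (z : int) : (q%:Z %| d%:Z ^+ k.+1 * z)%Z.
  by rewrite dvdz_mulr // -rmorphXn dvdzE.
have qd2 (z : int) : (q%:Z %| d%:Z ^+ k * d%:Z ^+ k * z)%Z.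
  rewrite -exprD; have -> : (k + k = k.+1 + k.-1)%N by rewrite addSn -addnS prednK.
  by rewrite exprD -mulrA qd'.
pose u (m : int) := 1 + m ^+ k * d%:Z ^+ k.
have cu m : coprimez (u m) q%:Z.
  apply: (coprime_mod_radical (n := 1) qd); last by rewrite coprimezE coprime1n.
  have dk : (d%:Z %| d%:Z ^+ k)%Z by rewrite -(prednK k0) exprS dvdz_mulr.
  by rewrite /u addrC addKr dvdz_mull.
have step m m' B l : (q%:Z %| m * m' - 1)%Z -> (d%:Z %| B - m ^+ s)%Z ->
  chi (B + m ^+ (s - k) * d%:Z ^+ k * l.+1%:Z) =
  chi (u m') * chi (B + m ^+ (s - k) * d%:Z ^+ k * l%:Z).
  move=> hm /dvdzP[z hB]; rewrite -dirichlet_multiplicative; apply: chi_congr.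
  have [v hv] : exists v, m ^+ s * m' ^+ k = m ^+ (s - k) + q%:Z * v.
    have : (q%:Z %| (m * m') ^+ k - 1)%Z.
      by rewrite subrX1 dvdz_mulr.
    move=> /dvdzP[v hv]; exists (m ^+ (s - k) * v).
    rewrite -{1}(subnK ks) exprD -mulrA -exprMn -[(m * m') ^+ k](subrK 1) hv.
    by ring.
  have -> : B = m ^+ s + z * d%:Z by rewrite -hB addrC subrK.
  set X := m ^+ (s - k); set D := d%:Z ^+ k.
  have -> : m ^+ s + z * d%:Z + X * D * l.+1%:Z -
     (u m' * (m ^+ s + z * d%:Z + X * D * l%:Z)) =
     D * (X - m ^+ s * m' ^+ k) - D * d%:Z * (m' ^+ k * z) - D * D * (m' ^+ k * X * l%:Z).
    by rewrite /u -/D intS; ring.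
  rewrite hv /D -exprSr !rpredB ?qd2 ?qd' //.
  by rewrite opprD addrA subrr add0r -mulrN mulrCA dvdz_mulr.
have [m hm] := inverse_mod cn; have [m' hm'] := inverse_mod cn'.
set G := fun l : nat => chi (A + n ^+ (s - k) * d%:Z ^+ k * l%:Z) *
     (chi (A' + n' ^+ (s - k) * d%:Z ^+ k * l%:Z))^*.
change (\sum_(l < d * W) G l = 0).
(* Replacing [l] by [l + 1] multiplies the summand by the constant [rho]. *)
pose rho := chi (u m) * (chi (u m'))^*.
have GS l : G l.+1 = rho * G l.
  by rewrite /G (step n m) // (step n' m') // rmorphM /rho; ring.
have Gper : G (d * W)%N = G 0%N.
  rewrite /G PoszM; congr (_ * _^*); apply: chi_congr;
    rewrite mulr0 addr0 addrAC subrr add0r.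
  - have -> : n ^+ (s - k) * d%:Z ^+ k * (d%:Z * W%:Z) = d%:Z ^+ k.+1 * (n ^+ (s - k) * W%:Z).
      by rewrite exprSr; ring.
    exact: qd'.
  - have -> : n' ^+ (s - k) * d%:Z ^+ k * (d%:Z * W%:Z) = d%:Z ^+ k.+1 * (n' ^+ (s - k) * W%:Z).
      by rewrite exprSr; ring.
    exact: qd'.
have tel D : \sum_(l < D) G l.+1 + G 0%N = \sum_(l < D) G l + G D.
  by rewrite -(big_ord_recr D (fun l => G l)) big_ord_recl /= addrC.
have := tel (d * W)%N; rewrite Gper => /addIr.
under eq_bigr do rewrite GS; rewrite -mulr_sumr => e.
(* A ratio 1 means chi(1 + g) = 1. As [q] divides g^2, the map h -> chi(1 + g h) is a homomorphism,
   hence trivial; primitivity gives q | g, and multiplying by n^k n'^k contradicts [nq]. *)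
have rho1 : rho != 1.
  apply: contra nq => /eqP r1.
  have eu : chi (u m) = chi (u m').
    rewrite -[LHS]mulr1 -[X in _ * X](expr1n _ 2) -(chi_norm chi (cu m')) normCKC.
    by rewrite mulrA -/rho r1 mul1r.
  pose g := (m ^+ k - m' ^+ k) * d%:Z ^+ k.
  have g1 : chi (1 + g) = 1.
    apply: (mulfI (chi_neq0 chi (cu m'))); rewrite mulr1 -[RHS]eu -dirichlet_multiplicative.
    apply: chi_congr; have -> : u m' * (1 + g) - u m =
       d%:Z ^+ k * d%:Z ^+ k * (m' ^+ k * (m ^+ k - m' ^+ k)) by rewrite /u /g; ring.
    exact: qd2.
  have gn (l : nat) : chi (1 + g * l%:Z) = 1.
    elim: l => [|l IH]; first by rewrite mulr0 addr0 chi1.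
    rewrite -[RHS]mulr1 -{1}IH -g1 -dirichlet_multiplicative; apply: chi_congr.
    have -> : 1 + g * l.+1%:Z - (1 + g * l%:Z) * (1 + g) =
       d%:Z ^+ k * d%:Z ^+ k * (- (m ^+ k - m' ^+ k) ^+ 2 * l%:Z) by rewrite /g intS; ring.
    exact: qd2.
  have /(primitive_dvd prim) : forall h : int, chi (1 + g * h) = 1.
    move=> h; rewrite -(gn `|(h %% q%:Z)%Z|%N); apply: chi_congr.
    rewrite gez0_abs ?modz_ge0 //; last by rewrite eqz_nat -lt0n; exact: q0.
    have -> : 1 + g * h - (1 + g * (h %% q%:Z)%Z) = g * (h - (h %% q%:Z)%Z) by ring.
    by rewrite dvdz_mull // -eqz_mod_dvd modz_mod.
  move=> /dvdzP[z gz].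
  have inv x x' : (q%:Z %| x * x' - 1)%Z -> exists v, x ^+ k * x' ^+ k = 1 + q%:Z * v.
    move=> hx; have : (q%:Z %| (x * x') ^+ k - 1)%Z.
      by rewrite subrX1 dvdz_mulr.
    by rewrite exprMn => /dvdzP[v hv]; exists v; rewrite [q%:Z * v]mulrC -hv addrC subrK.
  have [v hv] := inv _ _ hm; have [v' hv'] := inv _ _ hm'.
  have -> : d%:Z ^+ k * (n ^+ k - n' ^+ k) =
     d%:Z ^+ k * (n ^+ k * (1 + q%:Z * v') - n' ^+ k * (1 + q%:Z * v)) -
     q%:Z * (d%:Z ^+ k * (n ^+ k * v' - n' ^+ k * v)) by ring.
  rewrite -hv -hv' rpredB ?(dvdz_mulr _ (dvdzz q%:Z)) //.
  have -> : d%:Z ^+ k * (n ^+ k * (n' ^+ k * m' ^+ k) - n' ^+ k * (n ^+ k * m ^+ k)) =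
     - (n ^+ k * n' ^+ k) * g by rewrite /g; ring.
  by rewrite gz mulrA dvdz_mull.
have : (rho - 1) * \sum_(l < d * W) G l = 0 by rewrite mulrBl mul1r e subrr.
by move/eqP; rewrite mulf_eq0 subr_eq0 (negbTE rho1) => /eqP.
Qed.
End Orthogonality.

Lemma exprD_mod_sqr (a x : int) k : exists z,
  (a + x) ^+ k.+1 = a ^+ k.+1 + k.+1%:Z * a ^+ k * x + x ^+ 2 * z.
Proof.
elim: k => [|k [z IH]]; first by exists 0; rewrite !expr1 expr0; ring.
exists (a * z + k.+1%:Z * a ^+ k + x * z); rewrite exprS IH.
by rewrite [a ^+ k.+2]exprS [a ^+ k.+1]exprS (intS k.+1); ring.
Qed.

Section Moment.
Variables (R : realType) (q : nat) (chi : dirichlet_character R q).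
Hypothesis prim : primitive_character chi.

(** Taylor expansion at [n0]: second-order terms carry [(e ^ 2) ^ k.+2], which [q] divides. The
    first-order difference is the unit [n0 ^ k] times [k.+1 * e ^ (2 * k.+1).+1 * (t - t')], a
    nonzero integer of absolute value below [q] by the bound on [H]. *)
Lemma pow_diff_ndvd (k e H : nat) (n0 : int) (t t' : nat) :
  (0 < e)%N -> (q %| (e ^ 2) ^ k.+2)%N -> coprimez n0 q%:Z -> (k.+1 * e ^ (2 * k.+1).+1 * H <= q)%N ->
  (t < H)%N -> (t' < H)%N -> t != t' ->
  ~~ (q%:Z %| (e ^ 2)%N%:Z ^+ k.+1 * ((n0 + e%:Z * t%:Z) ^+ k.+1 - (n0 + e%:Z * t'%:Z) ^+ k.+1))%Z.
Proof.
move=> e0 qe cn0 hH tH t'H tt'.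
have q0 : (0 < q)%N := modulus_gt0 chi.
apply/negP.
have [z hz] := exprD_mod_sqr n0 (e%:Z * t%:Z) k.
have [z' hz'] := exprD_mod_sqr n0 (e%:Z * t'%:Z) k.
rewrite hz hz'; set D := (e ^ 2)%N%:Z ^+ k.+1.
have -> : D * (n0 ^+ k.+1 + k.+1%:Z * n0 ^+ k * (e%:Z * t%:Z) + (e%:Z * t%:Z) ^+ 2 * z -
   (n0 ^+ k.+1 + k.+1%:Z * n0 ^+ k * (e%:Z * t'%:Z) + (e%:Z * t'%:Z) ^+ 2 * z')) =
   n0 ^+ k * (k.+1%:Z * (D * e%:Z) * (t%:Z - t'%:Z)) +
   D * (e ^ 2)%N%:Z * (t%:Z ^+ 2 * z - t'%:Z ^+ 2 * z').
  by rewrite [(e ^ 2)%N%:Z]PoszX; ring.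
have h1 : (q%:Z %| D * (e ^ 2)%N%:Z * (t%:Z ^+ 2 * z - t'%:Z ^+ 2 * z'))%Z.
  by rewrite dvdz_mulr // -exprSr -PoszX dvdzE.
move=> h2; have := rpredB h2 h1; rewrite addrK.
rewrite Gauss_dvdzr; last by rewrite coprimez_sym coprimezXl.
have -> : D * e%:Z = (e ^ (2 * k.+1).+1)%N%:Z.
  by rewrite /D -PoszX -PoszM -expnM -expnSr.
rewrite -PoszM; set B := (k.+1 * _)%N.
have B0 : (0 < B)%N by rewrite muln_gt0 expn_gt0 e0.
rewrite dvdzE abszM !absz_nat => /dvdn_leq.
have tt0 : (0 < `|(t%:Z - t'%:Z)%R|)%N by rewrite absz_gt0 subr_eq0 eqz_nat.
rewrite muln_gt0 B0 tt0 => /(_ isT).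
have : (`|(t%:Z - t'%:Z)%R| < H)%N by move: tH t'H; clear; lia.
move: hH; rewrite -/B; move: B0; clear; nia.
Qed.

Lemma moment_le (k s e H Y W : nat) (n0 : int) (z : R[i]) :
  (k.+2 <= s)%N -> (0 < e)%N -> (0 < W)%N -> (q %| (e ^ 2) ^ k.+3)%N -> coprimez n0 q%:Z ->
  (k.+2 * e ^ (2 * k.+2).+1 * H <= q)%N -> ((s * Y) ^ k.+2 < e ^ 2 * W)%N -> `|z| = 1 ->
  \sum_(t < H) `|\sum_(y < Y) chi (n0 + e%:Z * t%:Z + (e ^ 2)%N%:Z * y%:Z) * z ^+ y| ^+ (2 * s) <=
  (((\prod_(j < k.+1) ((s * Y) ^ j.+1).+1) * (e ^ 2 * W)) * mean_value k.+2 s Y)%:R.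
Proof.
move=> ks e0 W0 qe cn0 hH hY z1.
have q0 : (0 < q)%N := modulus_gt0 chi.
set d := (e ^ 2)%N in qe hY *.
pose n (t : 'I_H) : int := n0 + e%:Z * t%:Z.
have cn t : coprimez (n t) q%:Z.
  apply: (coprime_mod_radical chi (e := e) (m := 2 * k.+3) (n := n0)) => //.
    by rewrite expnM.
  by rewrite /n addrC addKr dvdz_mulr.
pose L1 : finType := {dffun forall j : 'I_k.+1, 'I_((s * Y) ^ j.+1).+1}.
(* The range of the top coordinate is a multiple of [d], so that [sum_char_orth] sums over full
   periods; [hY] guarantees that the top symmetric function fits. *)
pose L : finType := (L1 * 'I_(d * W))%type.
pose A (m : int) (l : L1) : int := m ^+ s + \sum_(j < k.+1) (l j : nat)%:Z * d%:Z ^+ j.+1 * m ^+ (s - j.+1).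
have dA m l : (d%:Z %| A m l - m ^+ s)%Z.
  rewrite /A addrC addKr rpred_sum // => j _.
  by rewrite exprS [_ * (d%:Z * _)]mulrCA -mulrA dvdz_mulr.
(* The coordinate [ord0] is the first symmetric function, the sum of the y_i, so the twist by powers
   of [z] also depends on the label alone. *)
pose Phi (t : 'I_H) (l : L) : R[i] :=
  chi (A (n t) l.1 + n t ^+ (s - k.+2) * d%:Z ^+ k.+2 * (l.2 : nat)%:Z) * z ^+ (l.1 ord0).
have zz m : z ^+ m * (z ^+ m)^* = 1 by rewrite -normCK normrX z1 !expr1n.
have card_L : #|L| = ((\prod_(j < k.+1) ((s * Y) ^ j.+1).+1) * (d * W))%N.
  rewrite card_prod card_ord card_dep_ffun foldrE big_map big_enum /=; congr (_ * _)%N.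
  by apply: eq_bigr => j _; rewrite card_ord.
have orth t t' : \sum_l Phi t l * (Phi t' l)^* = #|L|%:R * (t == t')%:R.
  have [<-|tt'] := eqVneq t t'.
    rewrite mulr1 -sum1_card natr_sum; apply: eq_bigr => l _.
    rewrite -normCK normrM normrX z1 expr1n mulr1 chi_norm ?expr1n //.
    apply: (coprime_mod_radical chi (e := d) (m := k.+3) (n := n t ^+ s)) => //; last first.
      exact: coprimezXl.
    rewrite addrAC rpredD ?dA // exprS.
    by rewrite [_ * (d%:Z * _)]mulrCA -mulrA dvdz_mulr.
  rewrite mulr0 /L -(pair_big xpredT xpredT (fun l1 l2 => Phi t (l1, l2) * (Phi t' (l1, l2))^*)) /=.
  rewrite big1 // => l1 _; rewrite /Phi /=.
  rewrite (eq_bigr (fun l2 : 'I_(d * W) =>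
    chi (A (n t) l1 + n t ^+ (s - k.+2) * d%:Z ^+ k.+2 * (l2 : nat)%:Z) *
    (chi (A (n t') l1 + n t' ^+ (s - k.+2) * d%:Z ^+ k.+2 * (l2 : nat)%:Z))^*)) => [|l2 _]; last first.
    by rewrite [(_ * z ^+ _)^*]rmorphM /= -[RHS]mulr1 -(zz (l1 ord0)); ring.
  apply: sum_char_orth => //.
  by apply: pow_diff_ndvd e0 qe cn0 hH (ltn_ord t) (ltn_ord t') _.
pose yy (y : {ffun 'I_s -> 'I_Y}) : seq int := [seq (y i : nat)%:Z | i <- enum 'I_s].
have s_yy y : size (yy y) = s by rewrite size_map size_enum_ord.
pose E y j : nat := absz (esym_poly (yy y))`_j.
have EZ y j : (E y j)%:Z = (esym_poly (yy y))`_j.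
  rewrite /E gez0_abs // coef_esym_poly_ge0 // => x /mapP[i _ ->]; exact: lez_nat.
have E_le y j : (E y j <= (s * Y) ^ j)%N.
  rewrite -lez_nat EZ PoszX PoszM -[in leRHS](s_yy y) coef_esym_poly_le // => x /mapP[i _ ->].
  by apply/andP; split; rewrite lez_nat // ltnW.
have E_lt y : (E y k.+2 < d * W)%N by apply: leq_ltn_trans (E_le _ _) hY.
pose lab y : L := ([ffun j : 'I_k.+1 => Ordinal (E_le y j.+1 : (E y j.+1 < ((s * Y) ^ j.+1).+1)%N)],
   Ordinal (E_lt y)).
have labE (y : {ffun 'I_s -> 'I_Y}) t : \prod_(i < s) (chi (n t + d%:Z * (y i : nat)%:Z) * z ^+ (y i)) = Phi t (lab y).
  rewrite big_split /= /Phi ffunE /=; congr (_ * _); last first.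
    rewrite -expr_sum; congr (z ^+ _).
    by apply/eqP; rewrite -eqz_nat EZ coef1_esym_poly psum_nat; apply/eqP; congr Posz.
  (* The terms with more than [k.+2] factors [d] vanish modulo [q]. *)
  rewrite -chi_prod; apply: chi_congr.
  pose F j : int := (E y j)%:Z * d%:Z ^+ j * n t ^+ (s - j).
  have -> : \prod_(i < s) (n t + d%:Z * (y i : nat)%:Z) = \sum_(j < s.+1) F j.
    transitivity (\prod_(x <- yy y) (n t + x * d%:Z)).
      by rewrite big_map big_enum; apply: eq_bigr => i _; rewrite mulrC.
    by rewrite prod_esym_poly s_yy; apply: eq_bigr => j _; rewrite /F EZ.
  rewrite -(big_mkord xpredT F) (big_cat_nat _ (n := k.+3)) //=.
  rewrite big_mkord big_ord_recl big_ord_recr /=.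
  have -> : F 0%N = n t ^+ s by rewrite /F EZ coef0_esym_poly expr0 subn0 !mul1r.
  have -> : F (bump 0 k.+1) = n t ^+ (s - k.+2) * d%:Z ^+ k.+2 * (E y k.+2)%:Z.
    by rewrite /F /bump add1n; ring.
  have -> : A (n t) [ffun j : 'I_k.+1 => Ordinal (E_le y j.+1 : (E y j.+1 < ((s * Y) ^ j.+1).+1)%N)] =
      n t ^+ s + \sum_(i < k.+1) F (bump 0 i).
    by rewrite /A; congr (_ + _); apply: eq_bigr => j _; rewrite ffunE /= /F /bump add1n.
  set S1 := \sum_(i < k.+1) _; set S2 := \sum_(_ <= j < _) _.
  have e3 (a x : int) : a + (S1 + x) + S2 - (a + S1 + x) = S2 by ring.
  rewrite e3 /S2.
  rewrite big_seq rpred_sum // => j; rewrite mem_index_iota => /andP[kj _].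
  by rewrite /F -(subnK kj) addnC exprD mulrAC mulrC -mulrA dvdz_mulr // -PoszX dvdzE.
(* The sum of the squared multiplicities counts pairs with equal symmetric functions, hence with
   equal power sums: these are solutions of Vinogradov's system. *)
pose c (l : L) : R[i] := (#|[set y | lab y == l]|)%:R.
have fE t : (\sum_(y < Y) chi (n t + d%:Z * y%:Z) * z ^+ y) ^+ s = \sum_l c l * Phi t l.
  rewrite -[s in LHS](card_ord s) -prodr_const bigA_distr_bigA /=.
  under eq_bigr do rewrite labE.
  rewrite (partition_big lab xpredT) //=; apply: eq_bigr => l _.
  rewrite (eq_bigr (fun=> Phi t l)) => [|y /eqP -> //].
  by rewrite sumr_const mulr_natl; congr (_ *+ _); apply: eq_card => y; rewrite inE.
have L0 : 0 < #|L|%:R :> R[i].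
  have d0 : (0 < d)%N by rewrite expn_gt0 e0.
  rewrite ltr0n card_L muln_gt0 prodn_gt0 //=.
  by rewrite muln_gt0 d0.
have := bessel c L0 orth.
have -> : \sum_l `|c l| ^+ 2 = (#|[set yw : {ffun 'I_s -> 'I_Y} * {ffun 'I_s -> 'I_Y} | lab yw.1 == lab yw.2]|)%:R.
  transitivity (\sum_l \sum_(yw : {ffun 'I_s -> 'I_Y} * {ffun 'I_s -> 'I_Y})
      ((lab yw.1 == l) && (lab yw.2 == l))%:R : R[i]).
    apply: eq_bigr => l _; rewrite /c ger0_norm ?ler0n // expr2 -natrM -cardsX -sum1_card natr_sum big_mkcond.
    by apply: eq_bigr => yw _; rewrite !inE; case: (_ && _).
  rewrite exchange_big -sum1_card natr_sum [RHS]big_mkcond; apply: eq_bigr => yw _ /=.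
  rewrite inE (bigD1 (lab yw.1)) //= eqxx eq_sym big1 ?addr0 => [|l]; first by case: eqP.
  by rewrite eq_sym => /negbTE ->.
move=> h; apply: (@le_trans _ _ (\sum_t `|\sum_l c l * Phi t l| ^+ 2)).
  by apply: ler_sum => t _; rewrite -fE normrX -exprM [(s * 2)%N]mulnC.
apply: (le_trans h); rewrite -natrM ler_nat card_L leq_mul2l; apply/orP; right.
apply: subset_leq_card; apply/fintype.subsetP => -[y w]; rewrite !inE /= => /eqP ee.
have Eq j : (j <= k.+2)%N -> (esym_poly (yy y))`_j = (esym_poly (yy w))`_j.
  rewrite -!EZ; case: j => [|j] jk; first by rewrite !EZ !coef0_esym_poly.
  move: jk; rewrite leq_eqVlt => /orP[/eqP ->|jk].
    by have /(congr1 val) /= -> := congr1 snd ee.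
  have jk' : (j < k.+1)%N by [].
  have /(congr1 (fun f : {dffun _} => f (Ordinal jk'))) /= := congr1 fst ee.
  by rewrite !ffunE => /(congr1 val) /= ->.
have := esym_eq_psum Eq => h2.
apply/forallP => j; have := h2 j.+1; rewrite ltn_ord => /(_ isT).
by rewrite !psum_nat => -[->].
Qed.
End Moment.

Lemma sum_shift_le (C : numDomainType) (z : nat -> C) (N h : nat) :
  (forall n, `|z n| <= 1) -> `|\sum_(n < N) z n - \sum_(n < N) z (n + h)%N| <= (2 * h)%:R.
Proof.
move=> z1.
have e : \sum_(n < N) z n - \sum_(n < N) z (n + h)%N = \sum_(i < h) z i - \sum_(i < h) z (N + i)%N.
  have e1 : \sum_(n < N + h) z n = \sum_(n < N) z n + \sum_(i < h) z (N + i)%N by rewrite big_split_ord.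
  have e2 : \sum_(n < h + N) z n = \sum_(n < h) z n + \sum_(i < N) z (i + h)%N.
    by rewrite big_split_ord /=; congr (_ + _); apply: eq_bigr => i _; rewrite addnC.
  rewrite addnC e1 in e2.
  by apply/eqP; rewrite subr_eq addrAC eq_sym subr_eq -e2 eq_sym addrC.
have le_h (f : 'I_h -> C) : (forall i, `|f i| <= 1) -> `|\sum_i f i| <= h%:R.
  move=> f1; apply: (le_trans (ler_norm_sum _ _ _)).
  apply: (@le_trans _ _ (\sum_(i < h) 1)); first exact: ler_sum.
  by rewrite sumr_const card_ord.
rewrite e; apply: (le_trans (ler_normB _ _)); rewrite mul2n -addnn natrD.
by apply: lerD; apply: le_h.
Qed.

Section ShortSum.
Variables (R : realType) (q : nat) (chi : dirichlet_character R q).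
Hypothesis prim : primitive_character chi.

(** Averaging over the shifts [e * t + e ^ 2 * y] costs only the edge terms of length at most
    [e * H + e ^ 2 * Y]. Hölder's inequality over [t] brings in [moment_le], and the hypothesis on
    [D] says that the resulting bound beats the trivial one by [D]. *)
Lemma short_sum_le (k s e H Y W D N : nat) (z : R[i]) :
  (k.+2 <= s)%N -> (0 < e)%N -> (0 < W)%N -> (0 < H)%N -> (0 < Y)%N -> (q %| (e ^ 2) ^ k.+3)%N ->
  (k.+2 * e ^ (2 * k.+2).+1 * H <= q)%N -> ((s * Y) ^ k.+2 < e ^ 2 * W)%N ->
  (D ^ (2 * s) * (((\prod_(j < k.+1) ((s * Y) ^ j.+1).+1) * (e ^ 2 * W)) * mean_value k.+2 s Y) <=
   H * Y ^ (2 * s))%N -> `|z| = 1 ->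
  D%:R * `|\sum_(n < N) chi n%:Z * z ^+ n| <= (N + D * (2 * (e * H + e ^ 2 * Y)))%:R.
Proof.
move=> ks e0 W0 H0 Y0 qe hH hY hD z1.
have s0 : (0 < s)%N by apply: leq_trans ks.
set V := (_ * _ * mean_value _ _ _)%N in hD.
pose f (n : nat) := chi n%:Z * z ^+ n.
have f1 n : `|f n| <= 1 by rewrite normrM normrX z1 expr1n mulr1 chi_norm_le1.
pose T (n : nat) := \sum_(t < H) `|\sum_(y < Y) f (n + (e * t + e ^ 2 * y))%N|.
have T0 n : 0 <= T n by apply: sumr_ge0.
have chiE (n t y : nat) : `|\sum_(y < Y) f (n + (e * t + e ^ 2 * y))%N| =
   `|\sum_(y < Y) chi (n%:Z + e%:Z * t%:Z + (e ^ 2)%N%:Z * y%:Z) * (z ^+ (e ^ 2)) ^+ y|.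
  have -> : \sum_(y < Y) f (n + (e * t + e ^ 2 * y))%N =
    z ^+ (n + e * t) * \sum_(y < Y) chi (n%:Z + e%:Z * t%:Z + (e ^ 2)%N%:Z * y%:Z) * (z ^+ (e ^ 2)) ^+ y.
    rewrite mulr_sumr; apply: eq_bigr => y' _.
    by rewrite /f addnA exprD !PoszD !PoszM exprM; ring.
  by rewrite normrM normrX z1 expr1n mul1r.
(* If [n] shares a prime with [q], that prime divides [e], hence all the shifted arguments, and
   every inner sum vanishes; only coprime [n] need the moment bound. *)
have T_le n : D%:R * T n <= (H * Y)%:R.
  have [cn|ncn] := boolP (coprimez n%:Z q%:Z); last first.
    rewrite /T big1 ?mulr0 ?ler0n // => t _; rewrite big1 ?normr0 // => y _.
    rewrite /f chi_eq0 ?mul0r //; apply: contra ncn.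
    apply: (coprime_mod_radical chi (e := e) (m := 2 * k.+3)); first by rewrite expnM.
    by rewrite PoszD opprD addrA subrr add0r rpredN dvdzE /= dvdn_add ?dvdn_mulr // expnS -mulnA dvdn_mulr.
  have h1 : T n ^+ (2 * s) <= H%:R ^+ (2 * s).-1 * V%:R.
    have e2 : (2 * s = (2 * s).-1.+1)%N by rewrite prednK // muln_gt0.
    have := @power_mean _ 'I_H [set: 'I_H] (fun t => `|\sum_(y < Y) f (n + (e * t + e ^ 2 * y))%N|) (2 * s).-1.
    have eT (F : 'I_H -> R[i]) : \sum_(l in [set: 'I_H]) F l = \sum_l F l by apply: eq_bigl => l; rewrite inE.
    rewrite -e2 cardsT card_ord !eT => h; apply: (le_trans (h _)) => //.
    rewrite ler_wpM2l ?exprn_ge0 ?ler0n //.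
    under eq_bigr do rewrite (chiE _ _ 0%N).
    by apply: moment_le; rewrite ?normrX ?z1 ?expr1n.
  have s2 : (0 < 2 * s)%N by rewrite muln_gt0.
  rewrite -(ler_pXn2r s2) ?nnegrE ?mulr_ge0 ?ler0n // exprMn.
  apply: (@le_trans _ _ (D%:R ^+ (2 * s) * (H%:R ^+ (2 * s).-1 * V%:R))).
    by rewrite ler_wpM2l ?exprn_ge0 ?ler0n.
  rewrite mulrCA -!natrX -!natrM ler_nat (leq_trans (leq_mul (leqnn _) hD)) //.
  by rewrite mulnA -expnSr prednK // expnMn.
have HY0 : 0 < (H * Y)%:R :> R[i] by rewrite ltr0n muln_gt0 H0.
rewrite -(ler_pM2l HY0) mulrCA.
have -> : (H * Y)%:R * `|\sum_(n < N) chi n%:Z * z ^+ n| =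
   `|\sum_(t < H) \sum_(y < Y) \sum_(n < N) f n|.
  by rewrite !sumr_const !card_ord -mulrnA normrMn [(Y * H)%N]mulnC mulr_natl.
have e4 : \sum_(t < H) \sum_(y < Y) \sum_(n < N) f n =
   \sum_(t < H) \sum_(y < Y) (\sum_(n < N) f n - \sum_(n < N) f (n + (e * t + e ^ 2 * y))%N) +
   \sum_(n < N) \sum_(t < H) \sum_(y < Y) f (n + (e * t + e ^ 2 * y))%N.
  rewrite [X in _ + X]exchange_big -big_split /=; apply: eq_bigr => t _.
  by rewrite [X in _ + X]exchange_big -big_split /=; apply: eq_bigr => y _; rewrite subrK.
apply: (@le_trans _ _ (D%:R * ((H * Y)%:R * (2 * (e * H + e ^ 2 * Y))%:R + \sum_(n < N) T n))).
  rewrite ler_wpM2l ?ler0n // e4 (le_trans (ler_normD _ _)) // lerD //.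
    apply: (le_trans (ler_norm_sum _ _ _)).
    apply: (@le_trans _ _ (\sum_(t < H) \sum_(y < Y) (2 * (e * H + e ^ 2 * Y))%:R)); last first.
      by rewrite !sumr_const !card_ord -mulrnA [(Y * H)%N]mulnC -[leLHS]mulr_natl.
    apply: ler_sum => t _; apply: (le_trans (ler_norm_sum _ _ _)).
    apply: ler_sum => y _; apply: (le_trans (sum_shift_le N _ f1)).
    rewrite ler_nat leq_mul2l leq_add ?orbT // leq_mul2l ltnW ?orbT //.
  apply: (le_trans (ler_norm_sum _ _ _)); apply: ler_sum => n _.
  exact: ler_norm_sum.
rewrite mulrDr [in leRHS]natrD mulrDr addrC lerD //.
  rewrite mulr_sumr; apply: (@le_trans _ _ (\sum_(n < N) (H * Y)%:R)); first exact: ler_sum.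
  by rewrite sumr_const card_ord mulr_natr.
by rewrite [in leRHS]natrM le_eqVlt; apply/orP; left; apply/eqP; ring.
Qed.
End ShortSum.

(** * Completion *)

Section Cis.
Variable R : realType.
Implicit Types t : R.

Definition cis t : R[i] := (cos t +i* sin t)%C.

Lemma cis0 : cis 0 = 1.
Proof. by rewrite /cis cos0 sin0. Qed.

Lemma cisD t u : cis (t + u) = cis t * cis u.
Proof. by rewrite /cis cosD sinD; congr Complex; rewrite addrC. Qed.

Lemma cisMn t n : cis (t *+ n) = cis t ^+ n.
Proof. by elim: n => [|n IH]; rewrite ?mulr0n ?cis0 // mulrS cisD IH exprS. Qed.

Lemma cis_norm t : `|cis t| = 1.
Proof. by rewrite normc_def /= cos2Dsin2 sqrtr1. Qed.

Lemma cis_sub_inv t : cis t - cis (- t) = 2 * 'i%C * (sin t)%:C%C.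
Proof.
by rewrite /cis cosN sinN mulr_natl; apply/eqP; rewrite eq_complex /=; apply/andP; split; apply/eqP; ring.
Qed.

Lemma cis_prim_root (q : nat) : (0 < q)%N -> q.-primitive_root (cis (pi *+ 2 / q%:R)).
Proof.
move=> q0; have qn : q%:R != 0 :> R by rewrite pnatr_eq0 -lt0n.
apply/andP; split => //; apply/forallP => i; rewrite unity_rootE -cisMn.
have e : pi *+ 2 / q%:R *+ i.+1 = (pi * i.+1%:R / q%:R) *+ 2 :> R.
  by rewrite -[LHS]mulr_natr !mulr2n; ring.
have [->|iq] := eqVneq i.+1 q.
  by rewrite -[X in cis X]mulr_natr divfK // /cis cos2pi sin2pi eqxx.
have {}iq : (i.+1 < q)%N by rewrite ltn_neqAle iq ltn_ord.
rewrite e; apply/eqP/negbTE; rewrite eq_complex /= negb_and; apply/orP; left.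
have s0 : 0 < sin (pi * i.+1%:R / q%:R : R).
  apply: sin_gt0_pi; rewrite !mulr_gt0 ?pi_gt0 ?invr_gt0 ?ltr0n //=.
  by rewrite ltr_pdivrMr ?ltr0n // ltr_pM2l ?pi_gt0 // ltr_nat.
rewrite cos_mulr2n cos2sin2 lt_eqF // mulrnBl.
have : 0 < sin (pi * i.+1%:R / q%:R : R) ^+ 2 by rewrite exprn_gt0.
by set x := sin _ ^+ 2; lra.
Qed.

(** With y = x/2, sin x = 2 sin y cos y; on [0, pi/4] the cosine is at least cos(pi/4), so sin y is
    at least cos(pi/4) y by the mean value theorem, and cos(pi/4)^2 = 1/2. *)
Lemma sin_ge_half (x : R) : 0 <= x <= pi / 2 -> x / 2 <= sin x.
Proof.
move=> /andP[x0 x1].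
pose y := x / 2; have y0 : 0 <= y by rewrite divr_ge0.
have pi0 := pi_gt0 R.
have y1 : y <= pi / 4 by rewrite /y; lra.
have c4 : cos (pi / 4 : R) ^+ 2 = 1 / 2.
  have := cos_mulr2n (pi / 4 : R).
  have -> : (pi / 4) *+ 2 = pi / 2 :> R by rewrite mulr2n; lra.
  rewrite cos_pihalf => /eqP; rewrite eq_sym subr_eq0 => /eqP h.
  by move: h; rewrite mulr2n; lra.
have c40 : 0 <= cos (pi / 4 : R) by apply: cos_ge0_pihalf; lra.
have cmono (c : R) : 0 <= c <= pi / 4 -> cos (pi / 4) <= cos c.
  move=> /andP[c0 c1]; have [->//|cn] := eqVneq c (pi / 4).
  rewrite ltW // ltr_cos ?in_itv /=; first by rewrite lt_neqAle cn.
  - by apply/andP; split; lra.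
  - by apply/andP; split; lra.
have sy : cos (pi / 4) * y <= sin y.
  have [->|yn] := eqVneq y 0; first by rewrite sin0 mulr0.
  have yp : 0 < y by rewrite lt_neqAle eq_sym yn.
  have hc : {within `[0, y], continuous (@sin R)}%classic.
    by apply: continuous_subspaceT; exact: continuous_sin.
  have [c] := @MVT R sin cos 0 y yp (fun x _ => is_derive_sin x) hc.
  rewrite in_itv /= sin0 !subr0 => /andP[c0 cy] ->.
  by rewrite ler_wpM2r // cmono //; apply/andP; split; lra.
have -> : x = y *+ 2 by rewrite /y mulr2n; lra.
rewrite sin_mulr2n mulr2n.
have cy : cos (pi / 4) <= cos y by apply: cmono; rewrite y0.
have : cos (pi / 4) * (cos (pi / 4) * y) <= cos y * sin y.
  by apply: ler_pM => //; rewrite mulr_ge0.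
by rewrite mulrA -expr2 c4 mulr2n; lra.
Qed.

Lemma harmonic_le (n : nat) : \sum_(i < n) (i.+1%:R)^-1 <= 1 + ln n%:R :> R.
Proof.
case: n => [|n]; first by rewrite big_ord0 ln0 // addr0.
elim: n => [|n IH]; first by rewrite big_ord1 ln1 addr0 invr1.
rewrite big_ord_recr /= (le_trans (lerD IH (lexx _))) // -addrA lerD2l.
have n0 : 0 < n.+1%:R :> R by rewrite ltr0n.
have n1 : 0 < n.+2%:R :> R by rewrite ltr0n.
have := @le_ln1Dx R (- (n.+2%:R)^-1).
have e : 1 + - n.+2%:R^-1 = n.+1%:R / n.+2%:R :> R.
  have bn : n.+2%:R != 0 :> R by rewrite gt_eqF.
  apply/eqP; rewrite -(inj_eq (mulIf bn)) divfK // mulrDl mulNr mulVf // mul1r.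
  by rewrite -[n.+2%:R]natr1 addrK.
rewrite e ln_div ?posrE //.
have : -1 < - (n.+2%:R)^-1 :> R by rewrite ltrN2 invf_lt1 // ltr1n.
by move=> h /(_ h); move: (ln n.+1%:R) (ln n.+2%:R) (n.+2%:R^-1) => a b c; lra.
Qed.
End Cis.

Lemma abel_identity (C : comNzRingType) (x w : nat -> C) (m : nat) :
  \sum_(i < m.+1) x i * w i =
  \sum_(i < m) (\sum_(j < i.+1) x j) * (w i - w i.+1) + (\sum_(j < m.+1) x j) * w m.
Proof.
elim: m => [|m IH]; first by rewrite !big_ord1 big_ord0 add0r.
rewrite big_ord_recr /= IH [\sum_(i < m.+1) _ * (_ - _)]big_ord_recr /=.
rewrite [\sum_(j < m.+2) _]big_ord_recr /=; ring.
Qed.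

(** For nonincreasing nonnegative weights all coefficients in Abel's identity are nonnegative, so
    domination of partial sums passes to the weighted sums. *)
Lemma abel_le (C : numDomainType) (x w g : nat -> C) (m : nat) :
  (forall i, (i < m)%N -> w i.+1 <= w i) -> 0 <= w m ->
  (forall n, (n <= m.+1)%N -> `|\sum_(i < n) x i| <= \sum_(i < n) g i) ->
  `|\sum_(i < m.+1) x i * w i| <= \sum_(i < m.+1) g i * w i.
Proof.
move=> hw wm hS; rewrite !abel_identity.
apply: (le_trans (ler_normD _ _)); apply: lerD; last first.
  by rewrite normrM (ger0_norm wm) ler_wpM2r // hS.
apply: (le_trans (ler_norm_sum _ _ _)); apply: ler_sum => i _.
have wi : 0 <= w i - w i.+1 by rewrite subr_ge0 hw.
by rewrite normrM (ger0_norm wi) ler_wpM2r // hS // ltnS ltnW.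
Qed.

(** * Gauss sums of primitive characters *)

Section Gauss.
Variables (R : realType) (q : nat) (chi : dirichlet_character R q).
Hypothesis prim : primitive_character chi.
Hypothesis q1 : (1 < q)%N.
Variable w : R[i].
Hypothesis wq : q.-primitive_root w.

Let q0 : (0 < q)%N := ltnW q1.

Definition gauss (n : nat) : R[i] := \sum_(a < q) (chi (a : nat)%:Z)^* * w ^+ (a * n).

Lemma chi_nat_mod (n : nat) : chi (n %% q)%N%:Z = chi n%:Z.
Proof.
by apply: chi_congr; rewrite -eqz_mod_dvd !modz_nat modn_mod.
Qed.

Lemma gauss_mod m n : (m = n %[mod q])%N -> gauss m = gauss n.
Proof.
move=> mn; apply: eq_bigr => a _; congr (_ * _).
by rewrite mulnC [(a * n)%N]mulnC !exprM -(prim_expr_mod wq m) mn (prim_expr_mod wq).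
Qed.

Lemma gauss_mul (m n : nat) : coprime m q -> gauss n = (chi m%:Z)^* * gauss (m * n).
Proof.
move=> cm; pose h (a : 'I_q) : 'I_q := Ordinal (ltn_pmod (a * m) q0).
have hI : injective h.
  move=> a b /(congr1 val) /= e.
  have : (q%:Z %| (a * m)%N%:Z - (b * m)%N%:Z)%Z by rewrite -eqz_mod_dvd !modz_nat e.
  rewrite !PoszM -mulrBl Gauss_dvdzl; last by rewrite coprimez_sym coprimezE.
  by rewrite -eqz_mod_dvd !modz_nat !modn_small // => /eqP[/val_inj].
rewrite /gauss (reindex_inj hI) mulr_sumr; apply: eq_bigr => a _ /=.
rewrite chi_nat_mod PoszM dirichlet_multiplicative rmorphM /=.
by rewrite exprM (prim_expr_mod wq) -exprM mulnA; ring.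
Qed.

(** When gcd(n, q) > 1, a unit m congruent to 1 modulo q / gcd(n, q) fixes [n] modulo [q];
    primitivity provides one with chi(m) different from 1, which forces [gauss n] to vanish. *)
Lemma gaussE n : gauss n = chi n%:Z * gauss 1.
Proof.
have [cn|ncn] := boolP (coprime n q).
  by rewrite (gauss_mul 1 cn) muln1 mulrA -normCK chi_norm ?expr1n ?mul1r //.
rewrite chi_eq0 ?coprimezE // mul0r.
pose g := gcdn n q.
have g1 : (1 < g)%N by rewrite ltn_neqAle eq_sym ncn gcdn_gt0 q0 orbT.
have gq : (g %| q)%N by apply: dvdn_gcdr.
have dq : (q %/ g %| q)%N by apply: dvdn_div.
have [m [cm dm nm1]] : exists m : int, [/\ coprimez m q%:Z, ((q %/ g)%N%:Z %| m - 1)%Z & chi m <> 1].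
  apply: contrapT => h.
  have H (m : int) : coprimez m q%:Z -> ((q %/ g)%N%:Z %| m - 1)%Z -> chi m = 1.
    by move=> cm dm; apply: contrapT => e; apply: h; exists m.
  have := primitive_modulus prim dq H => e.
  by have := ltn_Pdiv g1 q0; rewrite e ltnn.
have qZ : q%:Z != 0 by rewrite eqz_nat -lt0n.
pose m' := `|(m %% q%:Z)%Z|%N.
have m'E : m'%:Z = (m %% q%:Z)%Z by rewrite gez0_abs ?modz_ge0.
have chim' : chi m'%:Z = chi m.
  by apply: chi_congr; rewrite -eqz_mod_dvd m'E modz_mod.
have cm' : coprime m' q.
  have : coprimez m'%:Z q%:Z by rewrite m'E /coprimez gcdz_modl.
  by rewrite coprimezE.
have := gauss_mul n cm'; rewrite chim' (@gauss_mod (m' * n) n); last first.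
  have [v nv] : exists v, n = (g * v)%N.
    by have /dvdnP[v ->] := dvdn_gcdl n q; exists v; rewrite mulnC.
  apply/eqP; rewrite -eqz_nat -!modz_nat eqz_mod_dvd PoszM -{2}[n%:Z]mul1r -mulrBl.
  have /dvdzP[t ->] : ((q %/ g)%N%:Z %| m'%:Z - 1)%Z.
    rewrite -(subrK m m'%:Z) -addrA rpredD // (@dvdz_trans q%:Z) ?dvdzE //.
    by rewrite -dvdzE -eqz_mod_dvd m'E modz_mod.
  rewrite nv PoszM (_ : t * (q %/ g)%N%:Z * (g%:Z * v%:Z) = q%:Z * (t * v%:Z)) ?dvdz_mulr //.
  by rewrite -[in RHS](divnK gq) PoszM; ring.
move=> /eqP; rewrite -subr_eq0 -{1}[gauss n]mul1r -mulrBl mulf_eq0 => /orP[|/eqP //].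
rewrite subr_eq0 eq_sym => /eqP e; case: nm1.
by rewrite -[LHS]conjCK e conjC1.
Qed.

(** Parseval's identity for n -> [gauss n], compared with [gaussE]: both sides contain the factor
    [P], the sum of |chi|^2, which cancels. *)
Lemma gauss_norm : `|gauss 1| ^+ 2 = q%:R.
Proof.
pose P := \sum_(a < q) `|chi (a : nat)%:Z| ^+ 2.
have P0 : P != 0.
  rewrite gt_eqF // /P (bigD1 (Ordinal q1)) //= chi1 normr1 expr1n ltr_pwDl //.
  by apply: sumr_ge0 => a _; rewrite exprn_ge0.
apply: (mulIf P0).
have <- : \sum_(n < q) gauss n * (gauss n)^* = q%:R * P.
  under eq_bigr do rewrite /gauss rmorph_sum big_distrlr.
  rewrite exchange_big /= /P mulr_sumr; apply: eq_bigr => a _.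
  rewrite exchange_big /=.
  transitivity (\sum_(b < q) (chi (a : nat)%:Z)^* * chi (b : nat)%:Z * (q%:R * (a == b :> nat)%:R)).
    apply: eq_bigr => b _; rewrite -(sum_prim_root_conj wq) // mulr_sumr; apply: eq_bigr => n _.
    by rewrite rmorphM /= conjCK [(n * a)%N]mulnC [(n * b)%N]mulnC; ring.
  rewrite (bigD1 a) //= eqxx big1 ?addr0 ?mulr1 => [|b ba].
    by rewrite mulrC normCK; ring.
  by rewrite (_ : (a == b :> nat) = false) ?mulr0 //; apply/negbTE; rewrite eq_sym.
by rewrite /P mulr_sumr; apply: eq_bigr => n _; rewrite (gaussE n) rmorphM /= !normCK; ring.
Qed.
End Gauss.

Lemma sum_ltn_indicator (A : pzRingType) (n B : nat) (f : nat -> A) :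
  \sum_(i < n) (i < B)%N%:R * f i = \sum_(i < minn n B) f i.
Proof.
elim: n => [|n IH]; first by rewrite min0n !big_ord0.
rewrite big_ord_recr /= IH; have [nB|Bn] := ltnP n B.
  by rewrite mul1r (minn_idPl nB) big_ord_recr.
by rewrite mul0r addr0 (minn_idPr (leqW Bn)).
Qed.

Lemma big_ord_pred (A : nmodType) (n : nat) (F : nat -> A) : (0 < n)%N ->
  \sum_(a < n) F a = F 0%N + \sum_(a < n.-1) F a.+1.
Proof. by case: n => // n _; rewrite big_ord_recl. Qed.

Section Completion.
Variables (R : realType) (q : nat) (chi : dirichlet_character R q).
Hypothesis prim : primitive_character chi.
Hypothesis q1 : (1 < q)%N.
Variables (D N1 : nat).
Hypothesis D0 : (0 < D)%N.
Hypothesis hS : forall (z : R[i]) (N : nat), `|z| = 1 ->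
  D%:R * `|\sum_(n < N) chi (n : nat)%:Z * z ^+ n| <= (N + D * N1)%:R.

Let q0 : (0 < q)%N := ltnW q1.
Let qr0 : 0 < q%:R :> R. Proof. by rewrite ltr0n. Qed.

Definition csc (a : nat) : R := (sin (pi * a%:R / q%:R))^-1.

Lemma angle_half (a : nat) : (2 * a <= q)%N -> 0 <= (pi : R) * a%:R / q%:R <= pi / 2.
Proof.
move=> aq; rewrite !mulr_ge0 ?pi_ge0 ?invr_ge0 ?ler0n //=.
rewrite ler_pdivrMr // mulrAC ler_pdivlMr ?ltr0n // -mulrA ler_pM2l ?pi_gt0 //.
by rewrite -natrM ler_nat mulnC.
Qed.

Lemma sin_angle_gt0 (a : nat) : (0 < a)%N -> (2 * a <= q)%N -> 0 < sin (pi * a%:R / q%:R : R).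
Proof.
move=> a0 aq; have /andP[_ h] := angle_half aq.
apply: sin_gt0_pi; rewrite !mulr_gt0 ?pi_gt0 ?invr_gt0 ?ltr0n //=.
by apply: le_lt_trans h _; have := pi_gt0 R; lra.
Qed.

Lemma csc_le (a : nat) : (0 < a)%N -> (2 * a <= q)%N -> csc a <= q%:R / a%:R.
Proof.
move=> a0 aq; have s0 := sin_angle_gt0 a0 aq.
have a0r : 0 < a%:R :> R by rewrite ltr0n.
rewrite /csc -[leRHS]invrK lef_pV2 ?posrE ?invr_gt0 ?divr_gt0 // invf_div.
apply: le_trans (sin_ge_half (angle_half aq)).
rewrite mulrAC ler_pM2r ?invr_gt0 // mulrAC.
rewrite -[leLHS]mul1r ler_pM2r // ler_pdivlMr ?ltr0n // mul1r pi_ge2 //.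
Qed.

Lemma csc_nonincr (a : nat) : (0 < a)%N -> (2 * a.+1 <= q)%N -> csc a.+1 <= csc a.
Proof.
move=> a0 aq; have aq' : (2 * a <= q)%N by apply: leq_trans aq; rewrite leq_mul2l leqnSn.
have := angle_half aq; have := angle_half aq' => /andP[h1 h2] /andP[h3 h4].
have pi0 := pi_gt0 R.
rewrite /csc lef_pV2 ?posrE ?sin_angle_gt0 // ltW // ltr_sin ?in_itv /=.
- by rewrite ltr_pM2r ?invr_gt0 // ltr_pM2l // ltr_nat.
- by apply/andP; split; lra.
- by apply/andP; split; lra.
Qed.

Definition half_bound : R := q%:R * ((1 + ln q%:R) / D%:R + (1 + ln N1.+1%:R)).

(** The trivial bound for short partial sums and [hS] for long ones are both dominated by the
    partial sums of 1/D plus the indicator of i <= N1. Against decreasing weights of size at most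
    q/(i+1) these give log(q)/D and log(N1 + 1). *)
Lemma half_sum_le (z : R[i]) (m : nat) : `|z| = 1 -> (2 * m <= q)%N ->
  `|\sum_(i < m) chi i.+1%:Z * z ^+ i.+1 * (csc i.+1)%:C%C| <= half_bound%:C%C.
Proof.
move=> z1 mq.
have lnq : 0 <= ln q%:R :> R by rewrite ln_ge0 // ler1n.
have lnN : 0 <= ln N1.+1%:R :> R by rewrite ln_ge0 // ler1n.
have Dr0 : 0 < D%:R :> R by rewrite ltr0n.
have DC0 : 0 < D%:R :> R[i] by rewrite ltr0n.
have hb0 : 0 <= half_bound.
  rewrite mulr_ge0 // addr_ge0 // ?addr_ge0 // divr_ge0 // ?addr_ge0 //; exact: ltW.
case: m mq => [|m] mq; first by rewrite big_ord0 normr0 ler0c.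
pose x (i : nat) := chi i.+1%:Z * z ^+ i.+1.
pose gR (i : nat) : R := D%:R^-1 + (i < N1.+1)%N%:R.
have x1 i : `|x i| <= 1 by rewrite normrM normrX z1 expr1n mulr1 chi_norm_le1.
have Sle n : `|\sum_(i < n) x i| <= \sum_(i < n) (gR i)%:C%C.
  have h1 : `|\sum_(i < n) x i| <= n%:R.
    apply: (le_trans (ler_norm_sum _ _ _)).
    apply: (@le_trans _ _ (\sum_(i < n) 1)); first exact: ler_sum.
    by rewrite sumr_const card_ord.
  (* The sum in [hS] starts at 0, so it has one more term; this is why [N1.+1] replaces [N1]. *)
  have h2 : D%:R * `|\sum_(i < n) x i| <= (n.+1 + D * N1)%:R.
    have := hS n.+1 z1; rewrite big_ord_recl /= chi_eq0 ?mul0r ?add0r //.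
    by rewrite coprimezE /= /coprime gcd0n gtn_eqF.
  have eg : \sum_(i < n) (gR i)%:C%C = n%:R / D%:R + (minn n N1.+1)%:R :> R[i].
    rewrite -[n in n%:R]card_ord -[#|_|%:R]mulr1 mulr_natl -sumr_const mulr_suml.
    have -> : (minn n N1.+1)%:R = \sum_(i < n) (i < N1.+1)%N%:R * 1 :> R[i].
      by rewrite (sum_ltn_indicator n N1.+1 (fun=> 1)) sumr_const card_ord.
    rewrite -big_split /=; apply: eq_bigr => i _.
    by rewrite rmorphD /= fmorphV !rmorph_nat mul1r mulr1.
  rewrite eg; have [nN|Nn] := leqP n N1.+1.
    by apply: (le_trans h1); rewrite lerDr divr_ge0 ?ler0n.
  rewrite -(ler_pM2l DC0) (le_trans h2) // mulrDr mulrCA divff ?gt_eqF // mulr1.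
  by rewrite -natrM -natrD ler_nat mulnS addnA leq_add2r -addn1 leq_add2l.
have : `|\sum_(i < m.+1) x i * (csc i.+1)%:C%C| <= \sum_(i < m.+1) (gR i)%:C%C * (csc i.+1)%:C%C.
  apply: (@abel_le _ x (fun i => (csc i.+1)%:C%C) (fun i => (gR i)%:C%C)) => //.
    move=> i im; rewrite lecR csc_nonincr //.
    by apply: leq_trans mq; rewrite leq_mul2l /= ltnS.
  by rewrite ler0c /csc invr_ge0 ltW // sin_angle_gt0.
move=> h; apply: (le_trans h).
under eq_bigr do rewrite -rmorphM.
rewrite -rmorph_sum lecR /half_bound.
have mq' : (m.+1 <= q)%N by lia.
apply: (@le_trans _ _ (\sum_(i < m.+1) (gR i * (q%:R / i.+1%:R)))).
  apply: ler_sum => i _; rewrite ler_wpM2l //.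
    by rewrite addr_ge0 ?invr_ge0 ?ler0n.
  by rewrite csc_le //; apply: leq_trans mq; rewrite leq_mul2l /=.
have -> : \sum_(i < m.+1) gR i * (q%:R / i.+1%:R) =
   q%:R * ((\sum_(i < m.+1) i.+1%:R^-1) / D%:R + \sum_(i < m.+1) (i < N1.+1)%N%:R * i.+1%:R^-1).
  rewrite mulrDr mulr_suml !mulr_sumr -big_split /=; apply: eq_bigr => i _.
  by rewrite /gR; ring.
rewrite ler_wpM2l ?ler0n // lerD //.
  rewrite ler_wpM2r ?invr_ge0 ?ler0n // (le_trans (harmonic_le R _)) // lerD2l.
  by rewrite ler_ln ?posrE ?ltr0n // ler_nat.
apply: le_trans (harmonic_le R N1.+1).
rewrite (sum_ltn_indicator m.+1 N1.+1 (fun i => i.+1%:R^-1 : R)).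
have -> : \sum_(i < N1.+1) (i.+1%:R)^-1 =
   \sum_(i < minn m.+1 N1.+1) (i.+1%:R)^-1 + \sum_(minn m.+1 N1.+1 <= i < N1.+1) (i.+1%:R)^-1 :> R.
  by rewrite -!(big_mkord xpredT (fun i => i.+1%:R^-1)) -big_cat_nat ?geq_minr.
by rewrite lerDl sumr_ge0 // => i _; rewrite invr_ge0.
Qed.

Lemma csc_sub (a : nat) : (a <= q)%N -> csc (q - a) = csc a.
Proof.
move=> aq; rewrite /csc natrB // mulrBr mulrBl mulfK ?gt_eqF //.
have -> : pi - pi * a%:R / q%:R = - (pi * a%:R / q%:R) + pi :> R by rewrite addrC.
by rewrite sinDpi sinN opprK.
Qed.

(** The weights decrease only up to q/2. The upper half is folded back by a -> q - a, at the cost of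
    chi(-1), a power of [z] and a conjugation. *)
Lemma csc_sum_le (z : R[i]) : `|z| = 1 ->
  `|\sum_(i < q.-1) (chi i.+1%:Z)^* * z ^+ i.+1 * (csc i.+1)%:C%C| <= (2 * half_bound)%:C%C.
Proof.
move=> z1.
have zJ : `|z^*| = 1 by rewrite norm_conjC.
have cscJ i : ((csc i)%:C%C)^* = (csc i)%:C%C by rewrite conj_Creal // complex_real.
pose m := q./2; pose m' := (q.-1 - m)%N.
have mq : (2 * m <= q)%N by rewrite /m; lia.
have mq' : (2 * m' <= q)%N by rewrite /m' /m; lia.
have em : q.-1 = (m + m')%N by rewrite /m' subnKC // /m; lia.
pose F (i : nat) := (chi i.+1%:Z)^* * z ^+ i.+1 * (csc i.+1)%:C%C.
have -> : \sum_(i < q.-1) F i = \sum_(i < m) F i + \sum_(i < m') F (m + i)%N.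
  by rewrite em big_split_ord.
have -> : \sum_(i < m') F (m + i)%N = \sum_(i < m') F (m + (m' - i.+1))%N.
  by rewrite (reindex_inj rev_ord_inj).
rewrite mulr_natl mulr2n rmorphD /=; apply: (le_trans (ler_normD _ _)); apply: lerD.
  rewrite -norm_conjC; apply: le_trans (half_sum_le zJ mq).
  rewrite rmorph_sum le_eqVlt; apply/orP; left; apply/eqP; congr `|_|; apply: eq_bigr => i _.
  by rewrite /F !rmorphM /= conjCK rmorphXn /= cscJ.
apply: le_trans (half_sum_le z1 mq').
have -> : \sum_(i < m') F (m + (m' - i.+1))%N = (chi (-1))^* * z ^+ q *
    (\sum_(i < m') chi i.+1%:Z * z ^+ i.+1 * (csc i.+1)%:C%C)^*.
  rewrite rmorph_sum mulr_sumr; apply: eq_bigr => i _; rewrite /F !rmorphM /= cscJ rmorphXn /=.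
  have iq : (i.+1 <= q)%N by have := ltn_ord i; rewrite /m'; lia.
  have -> : (m + (m' - i.+1)).+1 = (q - i.+1)%N by have := ltn_ord i; move: em; clear -q1; lia.
  rewrite csc_sub //.
  have -> : chi (q - i.+1)%N%:Z = chi (-1) * chi i.+1%:Z.
    rewrite -dirichlet_multiplicative; apply: chi_congr.
    by rewrite -subzn // mulN1r opprK subrK.
  have -> : z ^+ q = z ^+ (q - i.+1) * z ^+ i.+1 by rewrite -exprD subnK.
  have e : z ^+ i.+1 * (z^*) ^+ i.+1 = 1 by rewrite -exprMn -normCK z1 !expr1n.
  rewrite rmorphM /= [RHS](_ : _ = (chi (-1))^* * (chi i.+1%:Z)^* * z ^+ (q - i.+1) *
     (csc i.+1)%:C%C * (z ^+ i.+1 * (z^*) ^+ i.+1)); last by ring.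
  by rewrite e mulr1; ring.
rewrite normrM norm_conjC normrM norm_conjC normrX z1 expr1n mulr1.
by rewrite -[leRHS]mul1r ler_wpM2r // chi_norm_le1.
Qed.

Lemma completion (M : nat) :
  `|\sum_(1 <= n < M.+1) chi n%:Z| <=
  (2 * Num.sqrt q%:R * ((1 + ln q%:R) / D%:R + (1 + ln N1.+1%:R)))%:C%C.
Proof.
pose v : R[i] := cis (pi / q%:R).
pose w : R[i] := cis (pi *+ 2 / q%:R).
have wq : q.-primitive_root w by apply: cis_prim_root.
have wv : w = v ^+ 2 by rewrite /w /v -cisMn mulrnAl.
have v1 : `|v| = 1 by apply: cis_norm.
have v0 : v != 0 by rewrite -normr_gt0 v1 ltr01.
set S := \sum_(1 <= n < M.+1) _.
have G2 := gauss_norm prim q1 wq.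
set G := gauss chi w 1 in G2.
have GS : G * S = \sum_(a < q.-1) (chi a.+1%:Z)^* * \sum_(1 <= n < M.+1) w ^+ (a.+1 * n).
  rewrite /S mulr_sumr.
  under eq_bigr => n _ do rewrite mulrC -(gaussE prim q1 wq).
  rewrite exchange_big /= (big_ord_pred
    (fun a => \sum_(1 <= n < M.+1) (chi a%:Z)^* * w ^+ (a * n)) q0) [X in X + _]big1 ?add0r; last first.
    by move=> n _; rewrite chi_eq0 ?conjC0 ?mul0r // coprimezE /= /coprime gcd0n gtn_eqF.
  by apply: eq_bigr => a _; rewrite mulr_sumr.
pose ii : R[i] := 2 * 'i%C.
have ii2 : `|ii| = 2.
  by rewrite normrM normr_nat normc_def /= expr0n expr1n add0r sqrtr1 mulr1.
have ii0 : ii != 0 by rewrite -normr_gt0 ii2 ltr0n.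
(* As w = v^2, w^a - 1 is v^a times 2i sin(pi a/q); each geometric sum thus becomes a difference of
   two terms of the shape treated in [csc_sum_le]. *)
have geo a : (0 < a < q)%N -> ii * \sum_(1 <= n < M.+1) w ^+ (a * n) =
    ((v ^+ M.*2.+1) ^+ a - v ^+ a) * (csc a)%:C%C.
  move=> /andP[a0 aq].
  have s0 : 0 < sin (pi * a%:R / q%:R : R).
    apply: sin_gt0_pi; rewrite !mulr_gt0 ?pi_gt0 ?invr_gt0 ?ltr0n //=.
    by rewrite ltr_pdivrMr // ltr_pM2l ?pi_gt0 // ltr_nat.
  have sv : v ^+ a - (v ^+ a)^-1 = ii * (sin (pi * a%:R / q%:R))%:C%C.
    rewrite /ii -cis_sub_inv; have -> : pi * a%:R / q%:R = (pi / q%:R) *+ a :> R.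
      by rewrite -mulr_natr; ring.
    rewrite -mulNrn !cisMn -/v; congr (_ - _); rewrite -exprVn; congr (_ ^+ _).
    by apply: (mulfI v0); rewrite divff // -cisD subrr cis0.
  have sC : (sin (pi * a%:R / q%:R))%:C%C != 0 :> R[i].
    by rewrite eq_complex /= negb_and gt_eqF.
  have e : (w ^+ a - 1) * \sum_(1 <= n < M.+1) w ^+ (a * n) = w ^+ (a * M.+1) - w ^+ a.
    elim: (M) => [|K IH]; first by rewrite big_nil mulr0 muln1 subrr.
    rewrite big_nat_recr //= mulrDr IH [in RHS]mulnS exprD; ring.
  have va0 : v ^+ a != 0 by rewrite expf_neq0.
  have e1 : w ^+ a = v ^+ a * v ^+ a by rewrite wv -exprM mulnC mulnS muln1 exprD.
  apply: (mulIf sC); rewrite -[RHS]mulrA -rmorphM /csc mulVf ?gt_eqF // rmorph1 mulr1.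
  rewrite mulrAC -sv; apply: (mulfI va0).
  rewrite mulrA mulrBr divff // -e1 e e1 mulrBr; congr (_ - _).
  by rewrite wv -!exprM -exprD; congr (_ ^+ _); rewrite -muln2; ring.
have key : `|G| * `|S| <= (2 * half_bound)%:C%C.
  rewrite -normrM GS -(ler_pM2l (ltr0n _ 2)) -ii2 -normrM mulr_sumr.
  have -> : \sum_(a < q.-1) ii * ((chi a.+1%:Z)^* * \sum_(1 <= n < M.+1) w ^+ (a.+1 * n)) =
     \sum_(a < q.-1) (chi a.+1%:Z)^* * (v ^+ M.*2.+1) ^+ a.+1 * (csc a.+1)%:C%C -
     \sum_(a < q.-1) (chi a.+1%:Z)^* * v ^+ a.+1 * (csc a.+1)%:C%C.
    rewrite -sumrB; apply: eq_bigr => a _; rewrite mulrCA geo; first by ring.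
    by have := ltn_ord a; lia.
  rewrite ii2; set X := (2 * half_bound)%:C%C.
  have -> : 2 * X = X + X by rewrite mulr_natl mulr2n.
  apply: (le_trans (ler_normB _ _)).
  by apply: lerD; apply: csc_sum_le; rewrite ?normrX ?v1 ?expr1n.
have sq0 : 0 < Num.sqrt q%:R :> R by rewrite sqrtr_gt0.
have GE : `|G| = (Num.sqrt q%:R)%:C%C.
  have sC0 : 0 <= (Num.sqrt q%:R)%:C%C :> R[i] by rewrite ler0c sqrtr_ge0.
  apply/eqP; rewrite -(@eqrXn2 _ 2 `|G| _ isT (normr_ge0 _) sC0).
  by rewrite G2 -rmorphXn /= sqr_sqrtr ?ler0n // rmorph_nat.
have G0 : 0 < `|G| by rewrite GE ltcR.
rewrite -(ler_pM2l G0) (le_trans key) // GE -rmorphM lecR /half_bound.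
rewrite le_eqVlt; apply/orP; left; apply/eqP.
have sq : q%:R = Num.sqrt q%:R * Num.sqrt q%:R :> R by rewrite -expr2 sqr_sqrtr ?ltW.
move: ((1 + ln q%:R) / D%:R + _) => X; move: (Num.sqrt q%:R) sq => r ->; ring.
Qed.
End Completion.

(** * Choice of the parameters *)

Local Open Scope nat_scope.

Lemma prod_primes_logn (q : nat) : 0 < q -> q = \prod_(p <- primes q) p ^ logn p q.
Proof.
by move=> q0; rewrite {1}(prod_prime_decomp q0) prime_decompE big_map.
Qed.

(** Round each exponent of [q] up to a multiple of [m]: this adds at most [m.-1] to it, whence the
    power of the radical. *)
Lemma power_root (q m : nat) : 0 < q -> 0 < m ->
  exists e, [/\ 0 < e, q %| e ^ m & e ^ m <= q * radn q ^ m.-1].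
Proof.
move=> q0 m0; pose cl p := (logn p q + m.-1) %/ m.
exists (\prod_(p <- primes q) p ^ cl p).
have pr0 p : p \in primes q -> 0 < p by rewrite mem_primes => /andP[/prime_gt0].
have ex : (\prod_(p <- primes q) p ^ cl p) ^ m = \prod_(p <- primes q) p ^ (cl p * m).
  elim: (primes q) => [|p r IH]; first by rewrite !big_nil exp1n.
  by rewrite !big_cons expnMn IH -expnM.
split.
- by rewrite big_seq prodn_cond_gt0 // => p /pr0 p0; rewrite expn_gt0 p0.
- rewrite ex {1}(prod_primes_logn q0); elim: (primes q) => [|p r IH]; first by rewrite !big_nil.
  rewrite !big_cons dvdn_mul // dvdn_exp2l //.
  have := ltn_ceil (logn p q + m.-1) m0; rewrite -/(cl p) mulSn; lia.
- rewrite ex {2}(prod_primes_logn q0) /radn.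
  elim: (primes q) pr0 => [|p r IH] pr0; first by rewrite !big_nil exp1n.
  have p0 := pr0 p (mem_head _ _).
  rewrite !big_cons expnMn mulnACA leq_mul //; last first.
    by apply: IH => p' h; apply: pr0; rewrite in_cons h orbT.
  by rewrite -expnD leq_pexp2l // leq_divM.
Qed.

Lemma pow_succ_ge (m : nat) : 0 < m -> 2 * m ^ m <= m.+1 ^ m.
Proof.
move=> m0.
have H n : (m + n) * m ^ n <= m * m.+1 ^ n.
  elim: n => [|n IH]; first by rewrite addn0.
  rewrite !expnS; apply: (@leq_trans (m.+1 * ((m + n) * m ^ n))).
    by rewrite !mulnA leq_mul2r; apply/orP; right; nia.
  by rewrite [leqRHS]mulnCA leq_mul2l IH orbT.
by rewrite -(leq_pmul2l m0) mulnA [m * 2]mulnC mul2n -addnn.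
Qed.

Lemma quadratic_le_exp2 (k : nat) : 9 <= k -> 4 * (k.+1 * k) <= 2 ^ k.
Proof.
move=> k9; rewrite -(subnKC k9); elim: (k - 9) => [//|m IH].
rewrite addnS expnS (leq_trans _ (leq_mul (leqnn 2) IH)) //; nia.
Qed.

(** Each shrinking multiplies by at most 1 - 1/k, so [k ^ 2] of them gain 2^k, which exceeds 8K =
    4k(k+1). *)
Lemma iter_shrink_le (k b : nat) : 16 <= k -> 8 * 'C(k.+1, 2) * iter (k ^ 2) (shrink k) b <= b.
Proof.
move=> k16; have k0 : 0 < k by lia.
have h := shrink_bound (k ^ 2) b k0.
have h1 : 2 ^ k * k.-1 ^ (k ^ 2) <= k ^ (k ^ 2).
  have h2 : 2 * k.-1 ^ k.-1 <= k ^ k.-1 by have := @pow_succ_ge k.-1; rewrite prednK //; apply; lia.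
  have h3 : 2 * k.-1 ^ k <= k ^ k.
    have -> : k.-1 ^ k = k.-1 * k.-1 ^ k.-1 by rewrite -expnS prednK.
    have -> : k ^ k = k * k ^ k.-1 by rewrite -expnS prednK.
    by rewrite mulnCA leq_mul // leq_pred.
  rewrite -mulnn !expnM -expnMn leq_exp2r //.
have h4 : 8 * 'C(k.+1, 2) <= 2 ^ k.
  have -> : 8 * 'C(k.+1, 2) = 4 * (k.+1 * k) by rewrite -[8]/(4 * 2) -mulnA bin2_double.
  by apply: quadratic_le_exp2; lia.
have P0 : 0 < k ^ (k ^ 2) by rewrite expn_gt0 k0.
rewrite -(leq_pmul2r P0) -mulnA (leq_trans (leq_mul h4 h)) //.
by rewrite mulnCA leq_mul.
Qed.

Lemma sum_succ (n : nat) : \sum_(j < n) j.+1 = 'C(n.+1, 2).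
Proof. by rewrite -bin2_sum big_mkord big_ord_recl add0n; apply: eq_bigr. Qed.

Lemma exponent_le (k K s : nat) : 16 <= k -> 2 * K = k * k.+1 -> s = k ^ 2 + k * k ^ 2 ->
  k * (2 * s) + k + 3 * k * K + 2 * k * (k ^ 2 * (s + 2 * k ^ 2 + 2)) <= 4 * k ^ 6.
Proof.
move=> k16 K2 sE.
have h : 2 * (k * (2 * s) + k + 3 * k * K + 2 * k * (k ^ 2 * (s + 2 * k ^ 2 + 2))) <= 2 * (4 * k ^ 6).
  have -> : 2 * (k * (2 * s) + k + 3 * k * K + 2 * k * (k ^ 2 * (s + 2 * k ^ 2 + 2))) =
     4 * k ^ 6 + 12 * k ^ 5 + 4 * k ^ 4 + 15 * k ^ 3 + 3 * k ^ 2 + 2 * k.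
    have -> : 2 * (k * (2 * s) + k + 3 * k * K + 2 * k * (k ^ 2 * (s + 2 * k ^ 2 + 2))) =
      2 * (k * (2 * s) + k + 2 * k * (k ^ 2 * (s + 2 * k ^ 2 + 2))) + 3 * k * (2 * K) by ring.
    by rewrite K2 sE; ring.
  have st n : 16 * k ^ n <= k ^ n.+1 by rewrite expnS leq_mul2r k16 orbT.
  have := st 1; have := st 2; have := st 3; have := st 4; have := st 5; rewrite expn1.
  move: (k ^ 6) (k ^ 5) (k ^ 4) (k ^ 3) (k ^ 2) => *; lia.
by rewrite leq_mul2l in h.
Qed.

(** [Y] is the least power of p = 2^(2k) that is at least [e], the mean value bound is iterated
    [k ^ 2] times, [W] is minimal, and [H] is as large as the orthogonality condition permits. *)
Lemma parameters_exist (k q rad e : nat) :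
  16 <= k -> 0 < e -> 0 < rad -> e ^ (2 * k + 2) <= q * rad ^ (2 * k).+1 -> q <= e ^ (2 * k + 2) ->
  rad ^ (4 * k + 2) <= e -> 2 ^ (11 * k ^ 6) <= e ->
  let s := k ^ 2 + k * k ^ 2 in
  exists H Y W : nat, [/\ 0 < H, 0 < Y & 0 < W] /\
    [/\ k * e ^ (2 * k).+1 * H <= q, (s * Y) ^ k < e ^ 2 * W,
        k ^ (2 * s) * (((\prod_(j < k.-1) ((s * Y) ^ j.+1).+1) * (e ^ 2 * W)) * mean_value k s Y) <= H * Y ^ (2 * s) &
        (2 * (e * H + e ^ 2 * Y)).+1 <= e ^ 5].
Proof.
move=> k16 e0 rad0 eq_ge q_le hrad he s.
have k0 : 0 < k by lia.
pose p := 2 ^ (2 * k); pose b := up_log p e; pose Y := p ^ b.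
have p0 : 0 < p by rewrite expn_gt0.
have p1 : 1 < p by rewrite /p -{1}(expn0 2) ltn_exp2l //; lia.
have k9 : 9 <= k by apply: leq_trans k16.
have k4 : (2 * k) ^ 2 <= p.
  apply: (@leq_trans (2 ^ k)); last by rewrite leq_pexp2l // leq_pmull.
  apply: leq_trans (quadratic_le_exp2 k9).
  by rewrite expnMn -[2 ^ 2]/4 leq_mul2l /= -mulnn leq_mul2r leqnSn orbT.
have e1 : 1 < e.
  by apply: leq_trans he; rewrite -{1}(expn0 2) ltn_exp2l // muln_gt0 expn_gt0 k0.
have Ye : e <= Y by apply: up_logP.
have Yle : Y <= p * e.
  have b0 : 0 < b by rewrite up_log_gt0 p1.
  by rewrite /Y -(prednK b0) expnS leq_mul2l ltnW ?orbT // up_log_gtn.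
have Y0 : 0 < Y by rewrite expn_gt0 p0.
have s0 : 0 < s by rewrite addn_gt0 expn_gt0 k0.
pose K := 'C(k.+1, 2); pose g := iter (k ^ 2) (shrink k) b.
pose B := 2 ^ (4 * k ^ 6) * p ^ (K * g).
have k6 : 16 * k <= k ^ 6.
  rewrite expnS mulnC leq_mul2l (leq_trans k16) ?orbT //.
  by rewrite -{1}(expn1 k) leq_pexp2l.
(* Compare eighth powers: [p ^ (K * g)] contributes at most [p * e] by [iter_shrink_le], the radical
   at most [e ^ 4], and the remaining constants, including this [p], at most [e ^ 3], since 32 k^6 +
   10 k <= 33 k^6. *)
have Bk : B * k * rad ^ (2 * k).+1 <= e.
  rewrite -(leq_exp2r _ _ (isT : 0 < 8)) !expnMn.
  have h1 : (p ^ (K * g)) ^ 8 <= p * e.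
    rewrite -expnM mulnC mulnA; apply: leq_trans Yle; rewrite leq_pexp2l //.
    exact: iter_shrink_le.
  have h2 : (rad ^ (2 * k).+1) ^ 8 <= e ^ 4.
    by rewrite -expnM (_ : (2 * k).+1 * 8 = (4 * k + 2) * 4) ?expnM ?leq_exp2r //; lia.
  have h3 : (2 ^ (4 * k ^ 6)) ^ 8 * p * k ^ 8 <= e ^ 3.
    apply: (@leq_trans ((2 ^ (11 * k ^ 6)) ^ 3)); last by rewrite leq_exp2r.
    apply: (@leq_trans ((2 ^ (4 * k ^ 6)) ^ 8 * p * (2 ^ k) ^ 8)).
      by rewrite leq_mul2l leq_exp2r // ltnW ?orbT // ltn_expl.
    by rewrite /p -!expnM -!expnD leq_pexp2l //; move: k6; clear; lia.
  have -> : (2 ^ (4 * k ^ 6)) ^ 8 * (p ^ (K * g)) ^ 8 * k ^ 8 * (rad ^ (2 * k).+1) ^ 8 =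
    ((2 ^ (4 * k ^ 6)) ^ 8 * k ^ 8) * ((p ^ (K * g)) ^ 8 * (rad ^ (2 * k).+1) ^ 8) by ring.
  apply: (leq_trans (leq_mul (leqnn _) (leq_mul h1 h2))).
  have -> : (2 ^ (4 * k ^ 6)) ^ 8 * k ^ 8 * (p * e * e ^ 4) =
    ((2 ^ (4 * k ^ 6)) ^ 8 * p * k ^ 8) * e ^ 5 by rewrite [e ^ 5]expnS; ring.
  by apply: (leq_trans (leq_mul h3 (leqnn _))); rewrite -expnD.
have ke0 : 0 < k * e ^ (2 * k).+1 by rewrite muln_gt0 k0 expn_gt0 e0.
pose H := q %/ (k * e ^ (2 * k).+1).
have BH : B <= H.
  rewrite leq_divRL // -(leq_pmul2r (_ : 0 < rad ^ (2 * k).+1)) ?expn_gt0 ?rad0 //.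
  apply: leq_trans eq_ge; rewrite addn2 [e ^ (2 * k).+2]expnS.
  have -> : B * (k * e ^ (2 * k).+1) * rad ^ (2 * k).+1 = B * k * rad ^ (2 * k).+1 * e ^ (2 * k).+1 by ring.
  by rewrite leq_mul2r Bk orbT.
have H0 : 0 < H by apply: leq_trans BH; rewrite muln_gt0 !expn_gt0.
have He : H <= e.
  rewrite -(leq_pmul2r ke0) (leq_trans (leq_divM _ _)) // (leq_trans q_le) //.
  by rewrite addn2 expnS leq_mul2l leq_pmull ?orbT.
pose W := ((s * Y) ^ k %/ e ^ 2).+1.
have e20 : 0 < e ^ 2 by rewrite expn_gt0 e0.
exists H, Y, W; split=> //; split.
- by rewrite mulnC leq_divM.
- by rewrite [e ^ 2 * _]mulnC ltn_ceil.
- have sY0 : 0 < s * Y by rewrite muln_gt0 s0.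
  have esY : e ^ 2 <= (s * Y) ^ k.
    apply: (@leq_trans (Y ^ 2)); first by rewrite leq_exp2r.
    apply: (@leq_trans (Y ^ k)); first by rewrite leq_pexp2l //; apply: leq_trans k16.
    by rewrite leq_exp2r // leq_pmull.
  have hW : e ^ 2 * W <= 2 * (s * Y) ^ k.
    rewrite /W mulnS mul2n -addnn leq_add // mulnC leq_divM.
    done.
  have hP : \prod_(j < k.-1) ((s * Y) ^ j.+1).+1 <= 2 ^ k.-1 * (s * Y) ^ 'C(k, 2).
    apply: (@leq_trans (\prod_(j < k.-1) (2 * (s * Y) ^ j.+1))).
      by apply: leq_prod => j _; rewrite mul2n -addnn -add1n leq_add2r expn_gt0 sY0.
    rewrite big_split /= prod_nat_const card_ord -expn_sum leq_mul2l; apply/orP; right.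
    by rewrite sum_succ prednK.
  (* The box has about Y^K points, exactly what the mean value saves over Y^(2s); [H] only has to
     beat the constants and [p ^ (K * g)], that is [B]. *)
  have hL : (\prod_(j < k.-1) ((s * Y) ^ j.+1).+1) * (e ^ 2 * W) <= 2 ^ k * s ^ K * Y ^ K.
    apply: (leq_trans (leq_mul hP hW)).
    have e2k : 2 ^ k = 2 * 2 ^ k.-1 by rewrite -expnS prednK.
    rewrite e2k -[leqRHS]mulnA -(expnMn s Y K) /K binS bin1 expnD; apply: eq_leq; ring.
  have hV : mean_value k s Y * Y ^ K <= Y ^ (2 * s) * (p ^ (K * g) * p ^ (k ^ 2 * (s + 2 * k ^ 2 + 2))).
    have := @mean_value_bound k (2 * k) (k ^ 2) b (leq_trans (isT : 1 < 16) k16) k4.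
    have eK : Y ^ K = p ^ (b * K) by rewrite -expnM.
    have e2s : Y ^ (2 * s) = p ^ (2 * s * b) by rewrite -expnM mulnC.
    by rewrite eK e2s mulnA -!expnD.
  have s2 : s <= 2 ^ (3 * k).
    have k2 : k <= 2 ^ k by rewrite ltnW // ltn_expl.
    have k3 : k.+1 <= 2 ^ k by rewrite ltn_expl.
    have -> : s = k * k * k.+1 by rewrite /s -!mulnn; ring.
    by rewrite (_ : 3 * k = k + k + k) ?expnD ?leq_mul //; lia.
  have hC : k ^ (2 * s) * 2 ^ k * s ^ K * p ^ (k ^ 2 * (s + 2 * k ^ 2 + 2)) <= 2 ^ (4 * k ^ 6).
    apply: (@leq_trans ((2 ^ k) ^ (2 * s) * 2 ^ k * (2 ^ (3 * k)) ^ K * p ^ (k ^ 2 * (s + 2 * k ^ 2 + 2)))).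
      have h1 : k ^ (2 * s) <= (2 ^ k) ^ (2 * s).
        by rewrite leq_exp2r ?muln_gt0 // ltnW // ltn_expl.
      have h2 : s ^ K <= (2 ^ (3 * k)) ^ K by rewrite leq_exp2r // bin_gt0.
      by rewrite leq_mul // leq_mul // leq_mul.
    rewrite /p -!expnM -!expnD leq_pexp2l //.
    have K2 : 2 * K = k * k.+1 by rewrite /K bin2_double mulnC.
    by apply: exponent_le.
  apply: (@leq_trans (k ^ (2 * s) * 2 ^ k * s ^ K * (mean_value k s Y * Y ^ K))).
    apply: (leq_trans (leq_mul (leqnn _) (leq_mul hL (leqnn _)))).
    by apply: eq_leq; ring.
  apply: (leq_trans (leq_mul (leqnn _) hV)).
  apply: (@leq_trans (B * Y ^ (2 * s))); last by rewrite leq_mul2r BH orbT.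
  rewrite /B.
  set c1 := _ * s ^ K in hC *; set c2 := p ^ (k ^ 2 * _) in hC *.
  have -> : c1 * (Y ^ (2 * s) * (p ^ (K * g) * c2)) = (c1 * c2) * (p ^ (K * g) * Y ^ (2 * s)) by ring.
  by rewrite -[leqRHS]mulnA leq_mul2r hC orbT.
- have p5 : 5 * p <= e.
    apply: leq_trans he; apply: (@leq_trans (2 ^ 3 * p)); first by rewrite leq_mul2r orbT.
    by rewrite /p -expnD leq_pexp2l //; move: k6 k16; clear; lia.
  apply: (@leq_trans (5 * p * e ^ 3)); last first.
    by rewrite (leq_trans (leq_mul p5 (leqnn _))) // -expnS leq_pexp2l.
  have h1 : e * H <= e ^ 2 by rewrite -mulnn leq_mul.
  have h2 : e ^ 2 * Y <= p * e ^ 3 by rewrite (expnSr e 2) mulnCA leq_mul // .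
  have h3 : e ^ 2 <= p * e ^ 3.
    by rewrite (expnSr e 2) mulnCA leq_pmulr // muln_gt0 p0.
  have h4 : 0 < e ^ 2 by rewrite expn_gt0 e0.
  move: h1 h2 h3 h4; clear; rewrite -[5 * p * _]mulnA.
  move: (e * H) (e ^ 2) (p * e ^ 3) (e ^ 2 * Y) => *; lia.
Qed.

Local Open Scope ring_scope.

Lemma radn_gt0 (q : nat) : (0 < radn q)%N.
Proof.
rewrite /radn big_seq prodn_cond_gt0 // => p.
by rewrite mem_primes => /andP[/prime_gt0].
Qed.

Lemma ln_natX (R : realType) (a n : nat) : (0 < a)%N ->
  ln ((a ^ n)%N%:R) = n%:R * ln a%:R :> R.
Proof. by move=> a0; rewrite natrX lnXn ?ltr0n // mulr_natl. Qed.

Lemma char_sum_le (R : realType) (q k e M : nat) (chi : dirichlet_character R q) :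
  primitive_character chi -> (1 < q)%N -> (16 <= k)%N -> (0 < e)%N ->
  (q %| e ^ (2 * k + 2))%N -> (e ^ (2 * k + 2) <= q * radn q ^ (2 * k).+1)%N ->
  (radn q ^ (4 * k + 2) <= e)%N -> (2 ^ (11 * k ^ 6) <= e)%N ->
  `|\sum_(1 <= n < M.+1) chi n%:Z| <=
  (2 * Num.sqrt q%:R * ((1 + ln q%:R) / k%:R + (1 + 5 * ln e%:R)))%:C%C.
Proof.
move=> prim q1 k16 e0 qe eq_ge hrad he.
have q0 : (0 < q)%N := ltnW q1.
have q_le : (q <= e ^ (2 * k + 2))%N by rewrite dvdn_leq // expn_gt0 e0.
have [H [Y [W [[H0 Y0 W0] [hH hW hJ hN]]]]] :=
  parameters_exist k16 e0 (radn_gt0 q) eq_ge q_le hrad he.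
set s := (k ^ 2 + k * k ^ 2)%N in hW hJ.
pose N1 := (2 * (e * H + e ^ 2 * Y))%N.
have k0 : (0 < k)%N by apply: leq_trans k16.
have ks : (k <= s)%N by rewrite (leq_trans _ (leq_addr _ _)) // -mulnn leq_pmulr.
have kE : (k = k.-2.+2)%N by rewrite -subn2 -addn2 subnK // (leq_trans _ k16).
have hS (z : R[i]) (N : nat) : `|z| = 1 ->
    k%:R * `|\sum_(n < N) chi (n : nat)%:Z * z ^+ n| <= (N + k * N1)%:R.
  move=> z1; apply: (@short_sum_le R q chi prim k.-2 s e H Y W k N z) => //; rewrite -?kE //.
    by rewrite -expnM mulnS addnC.
  by rewrite prednK // -subn1 subn_gt0 (leq_trans _ k16).
have e1 : (1 < e)%N.
  by apply: leq_trans he; rewrite -{1}(expn0 2) ltn_exp2l // muln_gt0 expn_gt0 k0.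
apply: (le_trans (completion prim q1 k0 hS M)).
have sq0 : 0 < Num.sqrt q%:R :> R by rewrite sqrtr_gt0 ltr0n.
rewrite lecR ler_pM2l ?mulr_gt0 ?ltr0n // !lerD2l.
apply: (@le_trans _ _ (ln (e ^ 5)%N%:R)).
  by rewrite ler_ln ?posrE ?ltr0n ?expn_gt0 ?e0 // ler_nat.
by rewrite ln_natX.
Qed.

(** Here u = (log q)^(1/8) and l = log e. The first fraction is at most 32 u^7 and [l] at most 9
    u^7, so 78 = 32 + 1 + 45. *)
Lemma final_estimate (R : realFieldType) (u k l : R) : 16 <= k -> 1 <= u -> u / 8 < k + 1 ->
  (2 * k + 2) * l <= u ^+ 8 + (2 * k + 1) * u ^+ 6 ->
  (1 + u ^+ 8) / k + (1 + 5 * l) <= 78 * u ^+ 7.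
Proof.
move=> k16 u1 uk hl.
have k0 : 0 < k by lra.
have u6p : 0 <= u ^+ 6 by rewrite exprn_ge0 //; lra.
have u67 : u ^+ 6 <= u ^+ 7 by rewrite [leRHS]exprS ler_peMl.
have u78 : u ^+ 7 * u = u ^+ 8 by rewrite [RHS]exprSr.
have u17 : 1 <= u ^+ 7 by rewrite exprn_ege1.
have u18 : 1 <= u ^+ 8 by rewrite exprn_ege1.
move: (u ^+ 6) (u ^+ 7) (u ^+ 8) u6p u67 u78 u17 u18 hl => u6 u7 u8 u6p u67 u78 u17 u18 hl.
have u7p : 0 <= u7 by lra.
have h1 : (1 + u8) / k <= 32 * u7.
  rewrite ler_pdivrMr //.
  have : u7 * u <= u7 * (16 * k) by rewrite ler_wpM2l //; lra.
  lra.
have h2 : l <= 9 * u7.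
  have kk0 : 0 < 2 * k + 2 by lra.
  rewrite -(ler_pM2l kk0); apply: (le_trans hl).
  have h3 : u7 * u <= u7 * (16 * k + 16) by rewrite ler_wpM2l //; lra.
  have h4 : (2 * k + 1) * u6 <= (2 * k + 2) * u7 by apply: ler_pM => //; lra.
  lra.
lra.
Qed.

Theorem theorem2 (R : realType) :
  exists q0 : nat,
    forall eps : R, 0 < eps ->
      exists C : R, 0 < C /\
        forall q : nat, (q0 <= q)%N ->
          (radn q)%:R <= expR (ln (q%:R : R) `^ (3 / 4)) ->
          forall chi : dirichlet_character R q, primitive_character chi ->
            forall x : R, 1 <= x ->
              `|char_sum chi x|
                <= (C * Num.sqrt q%:R * ln (q%:R : R) `^ (7 / 8 + eps))%:C%C.
Proof.
(* Beyond this threshold the integer [k] chosen below is at least 16. *)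
exists (Num.truncn (expR (128 ^+ 8 : R))).+1 => eps eps0; exists 156; split; first by rewrite ltr0n.
move=> q hq hrad chi prim x _.
have hq' : expR (128 ^+ 8 : R) <= q%:R.
  by apply: le_trans (ltW (truncnS_gt _)) _; rewrite ler_nat.
have q0r : 0 < q%:R :> R by apply: lt_le_trans hq'; rewrite expR_gt0.
have q0 : (0 < q)%N by rewrite -(ltr0n R).
set L := ln (q%:R : R) in hrad *.
have hL : 128 ^+ 8 <= L.
  by rewrite -[leLHS]expRK ler_ln ?posrE ?expR_gt0.
pose u := L `^ (1 / 8).
have L1 : 1 <= L by apply: le_trans hL; rewrite exprn_ege1 // ler1n.
have L0 : 0 <= L by apply: le_trans L1.
have u0 : 0 <= u by rewrite powR_ge0.
have uX n : u ^+ n = L `^ (n%:R / 8).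
  by rewrite -powR_mulrn // -powRrM mul1r mulrC.
have uL : u ^+ 8 = L by rewrite uX divff ?pnatr_eq0 // powRr1.
have u128 : 128 <= u.
  by rewrite -(@ler_pXn2r _ 8) ?nnegrE ?ler0n // uL.
have u6 : L `^ (3 / 4) = u ^+ 6 by rewrite uX; congr (_ `^ _); clear; lra.
have u1 : 1 <= u by apply: le_trans u128; rewrite ler1n.
have u7 : L `^ (7 / 8) = u ^+ 7 by rewrite uX.
have q1 : (1 < q)%N.
  rewrite -(ltr_nat R) -ltr_ln ?posrE ?ltr0n // ln1 -/L; apply: lt_le_trans L1; exact: ltr01.
(* The divisor 8 gives (4k+2)(2k+2) <= 64 k^2 <= u^2, which together with log rad(q) <= u^6 yields
   [hrade]. *)
pose k := Num.truncn (u / 8).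
have u80 : 0 <= u / 8 by rewrite divr_ge0.
have /andP[ku uk] := truncn_itv u80; rewrite -/k in ku uk.
have k16 : (16 <= k)%N.
  rewrite -ltnS -(ltr_nat R); apply: le_lt_trans uk; rewrite ler_pdivlMr ?ltr0n //.
  by move: u128; clear; lra.
have k16r : 16 <= k%:R :> R by rewrite (ler_nat R 16).
have m0 : (0 < 2 * k + 2)%N by rewrite addn2.
have [e [e0 qe ele]] := power_root q0 m0.
have er0 : 0 < e%:R :> R by rewrite ltr0n.
have rad0 : 0 < (radn q)%:R :> R by rewrite ltr0n radn_gt0.
have lnrad : ln (radn q)%:R <= u ^+ 6 :> R.
  by rewrite -(@expRK R (u ^+ 6)) ler_ln ?posrE ?expR_gt0 // -u6.
have lnrad0 : 0 <= ln (radn q)%:R :> R by rewrite ln_ge0 // ler1n radn_gt0.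
have lne_ge : u ^+ 8 <= (2 * k%:R + 2) * ln e%:R.
  rewrite uL; have -> : (2 * k%:R + 2) * ln e%:R = ln ((e ^ (2 * k + 2))%N%:R) :> R.
    by rewrite ln_natX // natrD natrM.
  by rewrite ler_ln ?posrE ?ltr0n ?expn_gt0 ?e0 // ler_nat dvdn_leq // expn_gt0 e0.
have lne_le : (2 * k%:R + 2) * ln e%:R <= u ^+ 8 + (2 * k%:R + 1) * u ^+ 6.
  have h : ln ((e ^ (2 * k + 2))%N%:R) <= ln ((q * radn q ^ (2 * k).+1)%N%:R) :> R.
    rewrite ler_ln ?posrE ?ltr0n ?expn_gt0 ?e0 //; last by rewrite muln_gt0 q0 expn_gt0 radn_gt0.
    by rewrite ler_nat; move: ele; rewrite addn2.
  have rk : (0 < radn q ^ (2 * k).+1)%N by rewrite expn_gt0 radn_gt0.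
  move: h; rewrite natrM lnM ?posrE ?ltr0n // !ln_natX ?radn_gt0 // -/L -uL.
  rewrite natrD natrM -[(2 * k).+1%:R]natr1 natrM => h; apply: (le_trans h).
  by rewrite lerD2l ler_wpM2l // addr_ge0 // mulr_ge0.
have ku8 : 8 * k%:R <= u by rewrite mulrC -ler_pdivlMr ?ltr0n.
have u2 : 64 * k%:R ^+ 2 <= u ^+ 2.
  have -> : 64 * k%:R ^+ 2 = (8 * k%:R) ^+ 2 :> R by ring.
  by rewrite lerXn2r ?nnegrE ?mulr_ge0.
have u6p : 0 <= u ^+ 6 by rewrite exprn_ge0.
have k2 : (4 * k%:R + 2) * (2 * k%:R + 2) <= 64 * k%:R ^+ 2 :> R by move: k16r; clear; nra.
have kk0 : 0 < 2 * k%:R + 2 :> R by rewrite addr_gt0 // mulr_gt0 ?ltr0n // (leq_trans _ k16).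
have hrade : (radn q ^ (4 * k + 2) <= e)%N.
  rewrite -(ler_nat R) -ler_ln ?posrE ?ltr0n ?expn_gt0 ?radn_gt0 // ln_natX ?radn_gt0 //.
  rewrite -(ler_pM2l kk0); apply: le_trans lne_ge.
  rewrite natrD natrM -[8%N]/(2 + 6)%N exprD.
  apply: (@le_trans _ _ ((4 * k%:R + 2) * (2 * k%:R + 2) * u ^+ 6)).
    by rewrite mulrCA mulrA ler_wpM2l ?mulr_ge0 ?addr_ge0 ?mulr_ge0.
  by rewrite ler_wpM2r //; apply: le_trans u2.
(* After multiplication by 2k + 2 it suffices that 11 (2k+2) k^6 <= 44 k^8 <= (8k)^8 <= u^8. *)
have h2e : (2 ^ (11 * k ^ 6) <= e)%N.
  rewrite -(ler_nat R) -ler_ln ?posrE ?ltr0n ?expn_gt0 // ln_natX //.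
  rewrite -(ler_pM2l kk0); apply: le_trans lne_ge.
  have l2 : ln 2 <= 1 :> R.
    by apply: (@le_ln1Dx R 1); apply: lt_trans ltr01; rewrite ltrN10.
  have u8 : (8 * k%:R) ^+ 8 <= u ^+ 8 by rewrite lerXn2r ?nnegrE ?mulr_ge0.
  apply: le_trans u8.
  have kp n : 0 <= k%:R ^+ n :> R by rewrite exprn_ge0.
  apply: (@le_trans _ _ ((2 * k%:R + 2) * ((11 * k ^ 6)%N%:R * 1))).
    by rewrite (ler_wpM2l (ltW kk0)) // ler_wpM2l.
  rewrite mulr1 natrM natrX exprMn.
  have -> : k%:R ^+ 8 = k%:R ^+ 2 * k%:R ^+ 6 :> R by rewrite -exprD.
  rewrite [leRHS]mulrA [leLHS]mulrA ler_wpM2r //.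
  have c8 : 44 <= 8 ^+ 8 :> R.
    apply: (@le_trans _ _ (8 ^+ 2)); first by rewrite expr2; lra.
    by rewrite ler_weXn2l // ler1n.
  apply: (@le_trans _ _ (44 * k%:R ^+ 2)); last by rewrite ler_wpM2r.
  by rewrite expr2; move: k16r; clear; nra.
have hM : (e ^ (2 * k + 2) <= q * radn q ^ (2 * k).+1)%N by move: ele; rewrite addn2.
rewrite /char_sum; apply: (le_trans (char_sum_le (Num.truncn x) prim q1 k16 e0 qe hM hrade h2e)).
rewrite lecR -/L.
have hfin : (1 + L) / k%:R + (1 + 5 * ln e%:R) <= 78 * u ^+ 7.
  by rewrite -uL; apply: final_estimate => //; rewrite natr1.
have Leps : u ^+ 7 <= L `^ (7 / 8 + eps).
  by rewrite -u7 ler_powR // lerDl ltW.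
have sq0 : 0 <= Num.sqrt q%:R :> R by rewrite sqrtr_ge0.
apply: (@le_trans _ _ (2 * Num.sqrt q%:R * (78 * L `^ (7 / 8 + eps)))).
  rewrite ler_wpM2l ?mulr_ge0 //; apply: (le_trans hfin); by rewrite ler_wpM2l.
by rewrite le_eqVlt; apply/orP; left; apply/eqP; ring.
Qed.
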